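(* Let $f,g\in\mathrm{Diffeo}^-(\mathbb{R})$ with $f(0)=g(0)=0$ and $f\circ f=g\circ g$. Then there exists $h\in\mathrm{Diffeo}^+(\mathbb{R})$ with $h(0)=0$, commuting with $f\circ f$, such that $T_0 f=(T_0h)^{-1}\circ (T_0g)\circ (T_0h)$ if and only if one of the following holds: 1. $(T_0f)\circ(T_0f)\neq X$; 2. $0$ is an interior point of the fixed-point set $\mathrm{fix}(f\circ f)=\{x\in\mathbb{R}: f(f(x))=x\}$; 3. $(T_0f)\circ(T_0 f)=X$, $0$ is a boundary point of $\mathrm{fix}(f\circ f)$, and $T_0f=T_0g$.
   Context: $\mathrm{Diffeo}(\mathbb{R})$ is the group of $C^\infty$ diffeomorphisms of $\mathbb{R}$ under composition; $\mathrm{Diffeo}^+(\mathbb{R})$ (resp. $\mathrm{Diffeo}^-(\mathbb{R})$) is the set of orientation-preserving (resp. orientation-reversing) diffeomorphisms. For a diffeomorphism $\phi$ with $\phi(0)=0$, $T_0\phi=\phi'(0)X+\frac{\phi''(0)}{2}X^2+\cdots$ is its Taylor series at $0$, an element of the group of formally invertible real formal power series in $X$ (zero constant term, nonzero linear coefficient) under formal composition; $X$ denotes the identity series and $^{-1}$ the compositional inverse. *)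

(* Defs.v *)
From Stdlib Require Import Reals ClassicalEpsilon.
From Coquelicot Require Import Coquelicot.
Open Scope R_scope.

Definition smooth (f : R -> R) : Prop := forall (n : nat) (x : R), ex_derive_n f n x.

Definition diffeo (f : R -> R) : Prop :=
  smooth f /\ exists g : R -> R, smooth g /\ (forall x, g (f x) = x) /\ (forall x, f (g x) = x).

Definition diffeo_plus (f : R -> R) : Prop :=
  diffeo f /\ (forall x y, x < y -> f x < f y).

Definition diffeo_minus (f : R -> R) : Prop :=
  diffeo f /\ (forall x y, x < y -> f y < f x).

Definition fps := nat -> R.

Definition fps_X : fps := fun n => if Nat.eqb n 1 then 1 else 0.

Definition fps_one : fps := fun n => if Nat.eqb n 0 then 1 else 0.

Definition fps_mul (a b : fps) : fps :=
  fun n => sum_f_R0 (fun i => a i * b (n - i)%nat) n.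

Fixpoint fps_pow (b : fps) (k : nat) : fps :=
  match k with
  | O => fps_one
  | S k' => fps_mul b (fps_pow b k')
  end.

(* Formal composition a o b, for b with zero constant term:
   (a o b) = sum_k a_k b^k; the coefficient of X^n only involves k <= n. *)
Definition fps_comp (a b : fps) : fps :=
  fun n => sum_f_R0 (fun k => a k * fps_pow b k n) n.

(* Compositional inverse (chosen; unique when it exists). *)
Definition fps_inv (a : fps) : fps :=
  epsilon (inhabits fps_X)
    (fun b => b 0%nat = 0 /\ fps_comp a b = fps_X /\ fps_comp b a = fps_X).

Definition T0 (f : R -> R) : fps := fun n => Derive_n f n 0 / INR (Factorial.fact n).

Definition interior_fix0 (f : R -> R) : Prop :=
  exists eps, 0 < eps /\ forall x, Rabs x < eps -> f (f x) = x.

Definition boundary_fix0 (f : R -> R) : Prop :=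
  forall eps, 0 < eps ->
    (exists x, Rabs x < eps /\ f (f x) = x) /\
    (exists x, Rabs x < eps /\ f (f x) <> x).

(* Main.v *)
Require Import Defs.
From Stdlib Require Import Reals Arith Lra Lia Classical ClassicalEpsilon FunctionalExtensionality.
From Coquelicot Require Import Coquelicot.
Open Scope R_scope.

(* Write F = f o f = g o g.

   If T_0 F <> X, already T_0 f = T_0 g, and h = id works: at the first order n where f and g
   differ, equality of the squares forces f'(0) = g'(0) = -1 and n even, while the fact that both
   commute with F = x + a x^(p+1) + ... forces n = (-1)^p (p + 1).

   If F = id near 0, then x |-> (x - f x)/2 and x |-> (x - g x)/2 are global diffeomorphisms
   conjugating f and g to -x near 0; the resulting conjugacy is tangent to the identity and can be
   cut off inside fix(F), so that it commutes with F.

   If F is flat at 0 but F <> id near 0, every h commuting with F has T_0 h = X: otherwise h or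
   its inverse satisfies h x >= x + c x^m on a one-sided neighbourhood of 0, and then
   |F y - y| / y^K, for K large, does not decrease along the backward orbit of h, although
   flatness makes it tend to 0 there. Hence conjugation by T_0 h is trivial. *)

(** * Asymptotics and jets at the origin *)

(** Higher derivatives of a composite are never computed. The Taylor series is recognised as the
    only asymptotic expansion at 0, expansions compose by substitution, and every comparison of
    coefficients becomes uniqueness of a leading term.

    In the non-flat case the contradiction is one of parity: [n = (-1)^p (p + 1)] excludes odd [p]
    by sign, and even [p] because [n] is even.

    When [F = id] near 0, the conjugacy must commute with [F] also where nothing is known of [F]. It
    is therefore made the identity outside an interval [[-d, d]] that [F] fixes pointwise; [F] is
    increasing and fixes both ends, so it preserves the complement.

    In the flat case formal computation gives nothing, since every series commutes with [X]; the
    obstruction is dynamical. A nontrivial jet makes [h] move points at a polynomial rate, [F - id]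
    is smaller than every power, and commutation carries the size of [F - id] along orbits of [h].
    One step multiplies that size by at most [1 + C x^p]; this is outweighed by the [K]-th power of
    [h x / x >= 1 + c x^p], which dictates the choice of [K]. *)

Definition bigO (n : nat) (u : R -> R) : Prop :=
  exists C, locally 0 (fun x => Rabs (u x) <= C * Rabs x ^ n).

Lemma locally0_lt (e : R) : 0 < e -> locally 0 (fun x => Rabs x < e).
Proof.
  intros He. exists (mkposreal e He). intros x Hx.
  unfold ball in Hx. simpl in Hx. unfold AbsRing_ball, abs, minus, plus, opp in Hx.
  simpl in Hx. replace x with (x + - 0) by ring. exact Hx.
Qed.

Lemma locally0_inv (P : R -> Prop) :
  locally 0 P -> exists e, 0 < e /\ forall x, Rabs x < e -> P x.
Proof.
  intros [e He]. exists e. split; [apply cond_pos|]. intros x Hx. apply He.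
  unfold ball. simpl. unfold AbsRing_ball, abs, minus, plus, opp. simpl.
  replace (x + - 0) with x by ring. exact Hx.
Qed.

Lemma bigO_pos (n : nat) (u : R -> R) : bigO n u ->
  exists C e, 0 < C /\ 0 < e /\ forall x, Rabs x < e -> Rabs (u x) <= C * Rabs x ^ n.
Proof.
  intros [C HC]. destruct (locally0_inv _ HC) as [e [He H]].
  exists (Rabs C + 1), e. split; [pose proof (Rabs_pos C); lra|]. split; [exact He|].
  intros x Hx. eapply Rle_trans; [apply H, Hx|].
  apply Rmult_le_compat_r; [apply pow_le, Rabs_pos|]. pose proof (Rle_abs C). lra.
Qed.

Lemma bigO_intro (n : nat) (u : R -> R) (C e : R) : 0 < e ->
  (forall x, Rabs x < e -> Rabs (u x) <= C * Rabs x ^ n) -> bigO n u.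
Proof.
  intros He H. exists C. generalize (locally0_lt e He). apply filter_imp. exact H.
Qed.

Lemma bigO_ext_loc (n : nat) (u v : R -> R) :
  locally 0 (fun x => u x = v x) -> bigO n u -> bigO n v.
Proof.
  intros H [C HC]. exists C. generalize (filter_and _ _ H HC). apply filter_imp.
  intros x [E K]. rewrite <- E. exact K.
Qed.

Lemma bigO_ext (n : nat) (u v : R -> R) : (forall x, u x = v x) -> bigO n u -> bigO n v.
Proof. intros H. apply bigO_ext_loc, filter_forall, H. Qed.

Lemma bigO_plus (n : nat) (u v : R -> R) :
  bigO n u -> bigO n v -> bigO n (fun x => u x + v x).
Proof.
  intros [C HC] [D HD]. exists (C + D). generalize (filter_and _ _ HC HD).
  apply filter_imp. intros x [A B]. eapply Rle_trans; [apply Rabs_triang|]. lra.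
Qed.

Lemma bigO_mult (n m : nat) (u v : R -> R) :
  bigO n u -> bigO m v -> bigO (n + m) (fun x => u x * v x).
Proof.
  intros [C HC] [D HD]. exists (C * D). generalize (filter_and _ _ HC HD).
  apply filter_imp. intros x [A B]. rewrite Rabs_mult, pow_add.
  replace (C * D * (Rabs x ^ n * Rabs x ^ m)) with ((C * Rabs x ^ n) * (D * Rabs x ^ m)) by ring.
  apply Rmult_le_compat; auto using Rabs_pos.
Qed.

Lemma bigO_weaken (n m : nat) (u : R -> R) : (m <= n)%nat -> bigO n u -> bigO m u.
Proof.
  intros Hmn H. destruct (bigO_pos _ _ H) as [C [e [HC [He K]]]].
  apply (bigO_intro m u C (Rmin e 1)); [apply Rmin_pos; lra|].
  intros x Hx. eapply Rle_trans; [apply K; eapply Rlt_le_trans; [exact Hx|apply Rmin_l]|].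
  apply Rmult_le_compat_l; [lra|].
  assert (Hx1 : Rabs x <= 1) by (apply Rlt_le; eapply Rlt_le_trans; [exact Hx|apply Rmin_r]).
  replace n with (m + (n - m))%nat by lia. rewrite pow_add.
  rewrite <- (Rmult_1_r (Rabs x ^ m)) at 2.
  apply Rmult_le_compat_l; [apply pow_le, Rabs_pos|].
  rewrite <- (pow1 (n - m)). apply pow_incr. split; [apply Rabs_pos|exact Hx1].
Qed.

Lemma bigO_const (c : R) : bigO 0 (fun _ => c).
Proof. exists (Rabs c). apply filter_forall. intros x. simpl. lra. Qed.

Lemma bigO_pow (n : nat) : bigO n (fun x => x ^ n).
Proof. exists 1. apply filter_forall. intros x. rewrite RPow_abs. lra. Qed.

Lemma bigO_zero (n : nat) : bigO n (fun _ => 0).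
Proof. exists 0. apply filter_forall. intros x. rewrite Rabs_R0. lra. Qed.

Lemma bigO_scal (n : nat) (c : R) (u : R -> R) : bigO n u -> bigO n (fun x => c * u x).
Proof. intros H. exact (bigO_mult 0 n _ _ (bigO_const c) H). Qed.

Lemma bigO_monom (n m : nat) (c : R) : (n <= m)%nat -> bigO n (fun x => c * x ^ m).
Proof. intros H. apply bigO_weaken with m; [exact H|]. apply bigO_scal, bigO_pow. Qed.

Lemma bigO_minus (n : nat) (u v : R -> R) :
  bigO n u -> bigO n v -> bigO n (fun x => u x - v x).
Proof.
  intros Hu Hv. apply bigO_ext with (fun x => u x + (-1) * v x); [intros; ring|].
  apply bigO_plus; [exact Hu|apply bigO_scal, Hv].
Qed.

Lemma bigO_comp (n : nat) (u g : R -> R) :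
  bigO n u -> bigO 1 g -> bigO n (fun x => u (g x)).
Proof.
  intros Hu Hg. destruct (bigO_pos _ _ Hu) as [C [e [HC [He K]]]].
  destruct (bigO_pos _ _ Hg) as [D [e' [HD [He' L]]]].
  apply (bigO_intro n _ (C * D ^ n) (Rmin e' (e / D))).
  { apply Rmin_pos; [exact He'|apply Rdiv_lt_0_compat; assumption]. }
  intros x Hx.
  assert (H1 : Rabs (g x) <= D * Rabs x).
  { rewrite <- (pow_1 (Rabs x)). apply L. eapply Rlt_le_trans; [exact Hx|apply Rmin_l]. }
  assert (H2 : Rabs x < e / D) by (eapply Rlt_le_trans; [exact Hx|apply Rmin_r]).
  assert (H3 : D * Rabs x < e).
  { replace e with (D * (e / D)) by (field; lra). apply Rmult_lt_compat_l; assumption. }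
  eapply Rle_trans; [apply K; lra|].
  rewrite Rmult_assoc, <- Rpow_mult_distr. apply Rmult_le_compat_l; [lra|].
  apply pow_incr. split; [apply Rabs_pos|exact H1].
Qed.

Lemma bigO_sum (n : nat) (F : nat -> R -> R) (N : nat) :
  (forall k, (k <= N)%nat -> bigO n (F k)) -> bigO n (fun x => sum_f_R0 (fun k => F k x) N).
Proof.
  induction N as [|N IH]; intros H; simpl.
  - apply (bigO_ext n (F 0%nat)); [reflexivity|]. apply H; lia.
  - apply bigO_plus; [apply IH; intros k Hk; apply H; lia|apply H; lia].
Qed.

(** The coefficient [c] may be 0, so leading terms can be added and may cancel without leaving the
    predicate. *)
Definition lead (n : nat) (c : R) (u : R -> R) : Prop := bigO (S n) (fun x => u x - c * x ^ n).

Lemma lead_bigO (n : nat) (c : R) (u : R -> R) : lead n c u -> bigO n u.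
Proof.
  intros H. apply bigO_ext with (fun x => (u x - c * x ^ n) + c * x ^ n); [intros; ring|].
  apply bigO_plus; [apply bigO_weaken with (S n); [lia|exact H]|apply bigO_monom; lia].
Qed.

Lemma lead_monom (n : nat) (c : R) : lead n c (fun x => c * x ^ n).
Proof. apply (bigO_ext _ (fun _ => 0)); [intros; ring|apply bigO_zero]. Qed.

Lemma lead_zero (n : nat) (u : R -> R) : bigO (S n) u -> lead n 0 u.
Proof. apply bigO_ext. intros; ring. Qed.

Lemma lead_ext_loc (n : nat) (c : R) (u v : R -> R) :
  locally 0 (fun x => u x = v x) -> lead n c u -> lead n c v.
Proof.
  intros H. apply bigO_ext_loc. revert H. apply filter_imp. intros x ->. reflexivity.
Qed.

Lemma lead_ext (n : nat) (c : R) (u v : R -> R) :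
  (forall x, u x = v x) -> lead n c u -> lead n c v.
Proof. intros H. apply lead_ext_loc, filter_forall, H. Qed.

Lemma lead_plus (n : nat) (c d : R) (u v : R -> R) :
  lead n c u -> lead n d v -> lead n (c + d) (fun x => u x + v x).
Proof.
  intros Hu Hv. eapply bigO_ext; [|exact (bigO_plus _ _ _ Hu Hv)]. intros; simpl; ring.
Qed.

Lemma lead_mult (n m : nat) (c d : R) (u v : R -> R) :
  lead n c u -> lead m d v -> lead (n + m) (c * d) (fun x => u x * v x).
Proof.
  intros Hu Hv.
  apply bigO_ext with (fun x => (u x - c * x ^ n) * v x + (c * x ^ n) * (v x - d * x ^ m)).
  { intros x. rewrite pow_add. ring. }
  apply bigO_plus.
  - apply (bigO_mult (S n) m); [exact Hu|exact (lead_bigO _ _ _ Hv)].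
  - replace (S (n + m)) with (n + S m)%nat by lia.
    apply bigO_mult; [apply bigO_monom; lia|exact Hv].
Qed.

Lemma lead_scal (n : nat) (c d : R) (u : R -> R) :
  lead n d u -> lead n (c * d) (fun x => c * u x).
Proof.
  intros H. apply (lead_mult 0 n c d (fun _ => c)); [|exact H].
  eapply lead_ext; [|exact (lead_monom 0 c)]. intros; simpl; ring.
Qed.

Lemma lead_minus (n : nat) (c d : R) (u v : R -> R) :
  lead n c u -> lead n d v -> lead n (c - d) (fun x => u x - v x).
Proof.
  intros Hu Hv. eapply bigO_ext; [|exact (bigO_minus _ _ _ Hu Hv)]. intros; simpl; ring.
Qed.

Lemma lead_power (n k : nat) (c : R) (u : R -> R) :
  lead n c u -> lead (n * k) (c ^ k) (fun x => u x ^ k).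
Proof.
  intros H. induction k as [|k IH].
  - rewrite Nat.mul_0_r. eapply lead_ext; [|exact (lead_monom 0 1)]. intros; simpl; ring.
  - replace (n * S k)%nat with (n + n * k)%nat by lia. simpl. apply lead_mult; assumption.
Qed.

Lemma lead_comp (n : nat) (c l : R) (u y : R -> R) :
  lead n c u -> lead 1 l y -> lead n (c * l ^ n) (fun x => u (y x)).
Proof.
  intros Hu Hy.
  apply bigO_ext with (fun x => (u (y x) - c * y x ^ n) + (c * y x ^ n - c * l ^ n * x ^ n)).
  { intros; ring. }
  apply bigO_plus.
  - exact (bigO_comp _ (fun z => u z - c * z ^ n) y Hu (lead_bigO _ _ _ Hy)).
  - pose proof (lead_scal _ c _ _ (lead_power 1 n l y Hy)) as H.
    rewrite Nat.mul_1_l in H. exact H.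
Qed.

Lemma lead_unique (n : nat) (c d : R) (u : R -> R) : lead n c u -> lead n d u -> c = d.
Proof.
  intros Hc Hd. pose proof (bigO_minus _ _ _ Hd Hc) as H.
  destruct (bigO_pos _ _ H) as [C [e [HC [He K]]]].
  destruct (Req_dec c d) as [E|E]; [exact E|exfalso].
  assert (Hcd : 0 < Rabs (c - d)) by (apply Rabs_pos_lt; lra).
  (* Dividing by [x ^ n] leaves [|c - d| <= C * x], which fails once [C * x <= |c - d| / 2]. *)
  set (x := Rmin (e / 2) (Rabs (c - d) / (2 * C))).
  assert (Hx : 0 < x).
  { apply Rmin_pos; [lra|]. apply Rdiv_lt_0_compat; lra. }
  assert (Hxe : x <= e / 2) by apply Rmin_l.
  assert (Hx2 : C * x <= Rabs (c - d) / 2).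
  { replace (Rabs (c - d) / 2) with (C * (Rabs (c - d) / (2 * C))) by (field; lra).
    apply Rmult_le_compat_l; [lra|apply Rmin_r]. }
  specialize (K x). rewrite (Rabs_pos_eq x) in K by lra.
  assert (Hlt : x < e) by lra. specialize (K Hlt).
  replace (u x - d * x ^ n - (u x - c * x ^ n)) with ((c - d) * x ^ n) in K by ring.
  assert (Hp : 0 < x ^ n) by (apply pow_lt; exact Hx).
  rewrite Rabs_mult, (Rabs_pos_eq (x ^ n)) in K by lra. simpl in K.
  rewrite <- Rmult_assoc in K. apply Rmult_le_reg_r in K; [|exact Hp]. lra.
Qed.

(** Only the right side is treated, since [x ^ n] may be negative on the left; the left side is
    reached later by reflecting in 0. *)
Lemma lead_pos (n : nat) (c : R) (u : R -> R) : 0 < c -> lead n c u ->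
  exists e, 0 < e /\ forall x, 0 < x < e -> c / 2 * x ^ n <= u x.
Proof.
  intros Hc H. destruct (bigO_pos _ _ H) as [C [e [HC [He K]]]].
  exists (Rmin e (c / (2 * C))). split.
  { apply Rmin_pos; [lra|]. apply Rdiv_lt_0_compat; lra. }
  intros x [H0 H1].
  assert (Hxe : x < e) by (eapply Rlt_le_trans; [exact H1|apply Rmin_l]).
  assert (Hx2 : C * x <= c / 2).
  { replace (c / 2) with (C * (c / (2 * C))) by (field; lra).
    apply Rmult_le_compat_l; [lra|]. left. eapply Rlt_le_trans; [exact H1|apply Rmin_r]. }
  specialize (K x). rewrite (Rabs_pos_eq x) in K by lra. specialize (K Hxe).
  assert (Hp : 0 < x ^ n) by (apply pow_lt; exact H0).
  apply Rabs_le_between in K. simpl in K.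
  assert (C * (x * x ^ n) <= c / 2 * x ^ n).
  { rewrite <- Rmult_assoc. apply Rmult_le_compat_r; lra. }
  lra.
Qed.

(** * Jets and the formal operations *)

Definition peval (a : fps) (n : nat) (x : R) : R := sum_f_R0 (fun k => a k * x ^ k) n.

(** An asymptotic expansion to all orders. It passes through products and composites by estimates
    alone; [smooth_jet] and [jet_unique] translate back to [T0]. *)
Definition jet (f : R -> R) (a : fps) : Prop :=
  forall n, bigO (S n) (fun x => f x - peval a n x).

Lemma jet_ext_loc (f g : R -> R) (a : fps) :
  locally 0 (fun x => f x = g x) -> jet f a -> jet g a.
Proof.
  intros H J n. eapply bigO_ext_loc; [|exact (J n)].
  revert H. apply filter_imp. intros x ->. reflexivity.
Qed.

Lemma jet_lead (f : R -> R) (a : fps) (n : nat) :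
  jet f a -> (forall k, (k < n)%nat -> a k = 0) -> lead n (a n) f.
Proof.
  intros J H. eapply bigO_ext; [|exact (J n)]. intros x. simpl. f_equal.
  unfold peval. destruct n as [|n]; [reflexivity|]. simpl.
  rewrite (sum_eq _ (fun _ => 0)); [rewrite sum_cte; ring|].
  intros k Hk. rewrite H by lia. ring.
Qed.

Lemma jet_minus (f g : R -> R) (a b : fps) :
  jet f a -> jet g b -> jet (fun x => f x - g x) (fun n => a n - b n).
Proof.
  intros Jf Jg n. eapply bigO_ext; [|exact (bigO_minus _ _ _ (Jf n) (Jg n))].
  intros x. simpl. unfold peval.
  rewrite (sum_eq (fun k => (a k - b k) * x ^ k) (fun k => a k * x ^ k - b k * x ^ k))
    by (intros; ring).
  rewrite minus_sum. ring.
Qed.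

Lemma first_nonzero (a : fps) : (exists n, a n <> 0) ->
  exists n, a n <> 0 /\ forall k, (k < n)%nat -> a k = 0.
Proof.
  intros [n Hn]. induction n as [n IH] using lt_wf_ind.
  destruct (classic (exists k, (k < n)%nat /\ a k <> 0)) as [[k [Hk K]]|N].
  - exact (IH k Hk K).
  - exists n. split; [exact Hn|]. intros k Hk.
    destruct (Req_dec (a k) 0) as [E|E]; [exact E|]. exfalso. eauto.
Qed.

Lemma fps_neq_first (a b : fps) : a <> b ->
  exists n, a n - b n <> 0 /\ forall k, (k < n)%nat -> a k - b k = 0.
Proof.
  intros H. apply (first_nonzero (fun n => a n - b n)). apply NNPP. intros N. apply H.
  apply functional_extensionality. intros n.
  destruct (Req_dec (a n) (b n)) as [E|E]; [exact E|]. exfalso. apply N. exists n. lra.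
Qed.

(** At the first index where [a] and [b] differ, the zero function [f - f] would have a nonzero
    leading coefficient. *)
Lemma jet_unique (f : R -> R) (a b : fps) : jet f a -> jet f b -> a = b.
Proof.
  intros Ja Jb. apply NNPP. intros N. destruct (fps_neq_first _ _ N) as [n [Hn K]].
  apply Hn. apply (lead_unique n) with (fun x => f x - f x).
  - exact (jet_lead _ _ n (jet_minus _ _ _ _ Ja Jb) K).
  - apply lead_zero. apply bigO_ext with (fun _ => 0); [intros; ring|apply bigO_zero].
Qed.

Lemma jet_bigO1 (f : R -> R) (a : fps) : a 0%nat = 0 -> jet f a -> bigO 1 f.
Proof.
  intros H J. eapply bigO_ext; [|exact (J 0%nat)]. intros x. unfold peval. simpl.
  rewrite H. ring.
Qed.

Lemma jet_bigO0 (f : R -> R) (a : fps) : jet f a -> bigO 0 f.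
Proof.
  intros J. apply (lead_bigO 0 (a 0%nat)). apply jet_lead; [exact J|]. intros; lia.
Qed.

Lemma jet_one : jet (fun _ => 1) fps_one.
Proof.
  intros n. apply (bigO_ext _ (fun _ => 0)); [|apply bigO_zero]. intros x. unfold peval.
  induction n as [|n IH]; simpl; unfold fps_one in *; simpl in *; lra.
Qed.

Lemma jet_X : jet (fun x => x) fps_X.
Proof.
  intros [|n].
  - apply (bigO_ext _ (fun x => x ^ 1)); [|apply bigO_pow].
    intros x. unfold peval, fps_X. simpl. ring.
  - apply (bigO_ext _ (fun _ => 0)); [|apply bigO_zero]. intros x. unfold peval.
    induction n as [|n IH]; unfold fps_X in *; simpl in *; lra.
Qed.

(** Cutting [b] at degree [n - i] against [a i * x ^ i] keeps exactly the terms of total degree at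
    most [n], so the truncated Cauchy product has no remainder. *)
Lemma sum_triangle (a b : fps) (x : R) (n : nat) :
  sum_f_R0 (fun i => a i * x ^ i * peval b (n - i) x) n = peval (fps_mul a b) n x.
Proof.
  induction n as [|n IH].
  - unfold peval, fps_mul. simpl. ring.
  - rewrite tech5. unfold peval at 3. rewrite tech5. fold (peval (fps_mul a b) n x).
    rewrite <- IH. rewrite Nat.sub_diag.
    rewrite (sum_eq _ (fun i => a i * x ^ i * peval b (n - i) x
                                + a i * b (S n - i)%nat * x ^ S n)).
    + replace (fps_mul a b (S n))
        with (sum_f_R0 (fun i => a i * b (S n - i)%nat) n + a (S n) * b 0%nat)
        by (unfold fps_mul; rewrite tech5, Nat.sub_diag; reflexivity).
      rewrite plus_sum.
      rewrite Rmult_plus_distr_r, (Rmult_comm (sum_f_R0 _ n)), scal_sum.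
      change (peval b 0 x) with (b 0%nat * 1). ring.
    + intros i Hi. replace (S n - i)%nat with (S (n - i)) by lia.
      unfold peval. rewrite tech5.
      replace (x ^ S n) with (x ^ i * x ^ S (n - i))
        by (rewrite <- pow_add; f_equal; lia).
      ring.
Qed.

Lemma jet_mul (f g : R -> R) (a b : fps) :
  jet f a -> jet g b -> jet (fun x => f x * g x) (fps_mul a b).
Proof.
  intros Jf Jg n.
  (* The truncation degree of [b] varies with [i]: the factor [x ^ i] restores the order that the
     shorter truncation loses. *)
  apply bigO_ext with (fun x => (f x - peval a n x) * g x
     + sum_f_R0 (fun i => a i * x ^ i * (g x - peval b (n - i) x)) n).
  - intros x. rewrite <- sum_triangle.
    rewrite (sum_eq _ (fun i => a i * x ^ i * g x - a i * x ^ i * peval b (n - i) x))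
      by (intros; ring).
    rewrite minus_sum. rewrite <- (scal_sum (fun i => a i * x ^ i) n (g x)).
    fold (peval a n x). ring.
  - apply bigO_plus.
    + replace (S n) with (S n + 0)%nat by lia. apply bigO_mult; [apply Jf|].
      exact (jet_bigO0 _ _ Jg).
    + apply (bigO_sum (S n) (fun i x => a i * x ^ i * (g x - peval b (n - i) x))).
      intros i Hi. replace (S n) with (i + S (n - i))%nat by lia.
      apply bigO_mult; [apply bigO_monom; lia|apply Jg].
Qed.

Lemma jet_pow (g : R -> R) (b : fps) (k : nat) :
  jet g b -> jet (fun x => g x ^ k) (fps_pow b k).
Proof.
  intros J. induction k as [|k IH]; simpl; [exact jet_one|]. apply jet_mul; assumption.
Qed.

(** This makes the finite sum in [fps_comp] the full formal composition, and makes composition on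
    the right triangular. *)
Lemma fps_pow_low (b : fps) (k j : nat) :
  b 0%nat = 0 -> (j < k)%nat -> fps_pow b k j = 0.
Proof.
  intros Hb. revert j. induction k as [|k IH]; intros j Hj; [lia|]. simpl. unfold fps_mul.
  rewrite (sum_eq _ (fun _ => 0)); [rewrite sum_cte; ring|].
  intros [|i] Hi; [rewrite Hb; ring|]. rewrite IH by lia. ring.
Qed.

Lemma fps_pow_diag (b : fps) (k : nat) :
  b 0%nat = 0 -> fps_pow b k k = b 1%nat ^ k.
Proof.
  intros Hb. induction k as [|k IH]; [reflexivity|]. simpl. unfold fps_mul.
  rewrite decomp_sum by lia. rewrite Hb. simpl pred.
  destruct k as [|k].
  - simpl. unfold fps_one. simpl. ring.
  - rewrite decomp_sum by lia. simpl pred.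
    rewrite (sum_eq _ (fun _ => 0)).
    + rewrite sum_cte. replace (S (S k) - 1)%nat with (S k) by lia. rewrite IH. ring.
    + intros i Hi. rewrite (fps_pow_low b (S k)) by (assumption || lia). ring.
Qed.

Lemma jet_comp (f g : R -> R) (a b : fps) :
  b 0%nat = 0 -> jet f a -> jet g b -> jet (fun x => f (g x)) (fps_comp a b).
Proof.
  intros Hb Jf Jg n.
  apply bigO_ext with (fun x => (f (g x) - peval a n (g x))
     + sum_f_R0 (fun k => a k * (g x ^ k - peval (fps_pow b k) n x)) n).
  - intros x.
    rewrite (sum_eq _ (fun k => a k * g x ^ k - a k * peval (fps_pow b k) n x))
      by (intros; ring).
    rewrite minus_sum. fold (peval a n (g x)).
    enough (H : peval (fps_comp a b) n x
                = sum_f_R0 (fun k => a k * peval (fps_pow b k) n x) n) by (rewrite H; ring).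
    unfold peval.
    rewrite (sum_eq (fun k => fps_comp a b k * x ^ k)
       (fun j => sum_f_R0 (fun k => a k * (fps_pow b k j * x ^ j)) n)).
    + assert (Hsw : forall (u : nat -> nat -> R) N M,
        sum_f_R0 (fun j => sum_f_R0 (fun k => u j k) M) N
        = sum_f_R0 (fun k => sum_f_R0 (fun j => u j k) N) M).
      { intros u N M. induction N as [|N IH]; simpl; [reflexivity|].
        rewrite IH, <- plus_sum. reflexivity. }
      rewrite Hsw. apply sum_eq. intros k Hk. rewrite scal_sum. apply sum_eq. intros; ring.
    + intros j Hj. unfold fps_comp. rewrite Rmult_comm, scal_sum.
      (* The range [k <= j] extends to [k <= n], since the added powers of [b] have no term of
         degree [j]; the two sums can then be exchanged. *)
      assert (E : forall d, sum_f_R0 (fun i => a i * fps_pow b i j * x ^ j) j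
         = sum_f_R0 (fun k => a k * (fps_pow b k j * x ^ j)) (j + d)).
      { induction d as [|d IH].
        - rewrite Nat.add_0_r. apply sum_eq. intros; ring.
        - rewrite Nat.add_succ_r, tech5, <- IH.
          rewrite (fps_pow_low b (S (j + d))) by (assumption || lia). ring. }
      rewrite (E (n - j)%nat). f_equal. lia.
  - apply bigO_plus.
    + exact (bigO_comp _ _ _ (Jf n) (jet_bigO1 _ _ Hb Jg)).
    + apply (bigO_sum (S n) (fun k x => a k * (g x ^ k - peval (fps_pow b k) n x))).
      intros k Hk. apply bigO_scal. apply (jet_pow g b k Jg).
Qed.

(* Composition on the right by an invertible series is triangular. *)
Lemma fps_comp_cancel_r (a b c : fps) :
  c 0%nat = 0 -> c 1%nat <> 0 -> fps_comp a c = fps_comp b c -> a = b.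
Proof.
  intros H0 H1 E. apply functional_extensionality. intros n.
  induction n as [n IH] using lt_wf_ind.
  pose proof (f_equal (fun s => s n) E) as En. unfold fps_comp in En.
  assert (Hd : fps_pow c n n <> 0) by (rewrite fps_pow_diag by exact H0; apply pow_nonzero, H1).
  destruct n as [|n].
  - simpl in En. apply Rmult_eq_reg_r with (fps_pow c 0%nat 0%nat); assumption.
  - rewrite !tech5 in En.
    rewrite (sum_eq (fun k => a k * _) (fun k => b k * fps_pow c k (S n))) in En.
    + apply Rplus_eq_reg_l in En. apply Rmult_eq_reg_r in En; assumption.
    + intros k Hk. rewrite IH by lia. reflexivity.
Qed.

(** * Smooth functions *)

(** Each level carries its derivative as a function, so closure under products, composites and
    reciprocals is an induction using only first-order rules. *)
Fixpoint Cn (n : nat) (f : R -> R) : Prop :=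
  match n with
  | O => True
  | S n => exists df, (forall x, is_derive f x (df x)) /\ Cn n df
  end.

Lemma Derive_n_S (f : R -> R) (n : nat) (x : R) : Derive_n f (S n) x = Derive_n (Derive f) n x.
Proof.
  change (Derive f) with (Derive_n f 1). rewrite Derive_n_comp, Nat.add_1_r. reflexivity.
Qed.

Lemma smooth_is_derive (f : R -> R) (x : R) : smooth f -> is_derive f x (Derive f x).
Proof. intros H. apply Derive_correct. exact (H 1%nat x). Qed.

Lemma smooth_Derive (f : R -> R) : smooth f -> smooth (Derive f).
Proof.
  intros H [|n] x; [exact I|]. simpl.
  apply ex_derive_ext with (Derive_n f (S n)); [intros; apply Derive_n_S|].
  exact (H (S (S n)) x).
Qed.

Lemma smooth_Cn (f : R -> R) : smooth f <-> forall n, Cn n f.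
Proof.
  split.
  - intros H n. revert f H. induction n as [|n IH]; intros f H; [exact I|].
    exists (Derive f). split; [intros; apply smooth_is_derive, H|]. apply IH, smooth_Derive, H.
  - intros H n. specialize (H n). revert f H.
    induction n as [|n IH]; intros f H x; [exact I|].
    destruct H as [df [D C]].
    assert (E : Derive f = df)
      by (apply functional_extensionality; intros y; apply is_derive_unique, D).
    destruct n as [|n]; [exists (df x); apply D|].
    simpl. apply ex_derive_ext with (Derive_n df n).
    + intros y. rewrite <- E, <- Derive_n_S. reflexivity.
    + exact (IH df C x).
Qed.

Lemma Cn_weaken (n : nat) (f : R -> R) : Cn (S n) f -> Cn n f.
Proof.
  revert f. induction n as [|n IH]; intros f H; [exact I|].
  destruct H as [df [D C]]. exists df. split; [exact D|apply IH, C].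
Qed.

Lemma Cn_const (n : nat) (c : R) : Cn n (fun _ => c).
Proof.
  revert c. induction n as [|n IH]; intros c; [exact I|].
  exists (fun _ => 0). split; [intros x; apply @is_derive_const|apply IH].
Qed.

Lemma Cn_id (n : nat) : Cn n (fun x => x).
Proof.
  destruct n as [|n]; [exact I|].
  exists (fun _ => 1). split; [intros x; apply @is_derive_id|apply Cn_const].
Qed.

Lemma Cn_plus (n : nat) (f g : R -> R) : Cn n f -> Cn n g -> Cn n (fun x => f x + g x).
Proof.
  revert f g. induction n as [|n IH]; intros f g Hf Hg; [exact I|].
  destruct Hf as [df [Df Cf]], Hg as [dg [Dg Cg]].
  exists (fun x => df x + dg x). split; [|apply IH; assumption].
  intros x. apply @is_derive_plus; auto.
Qed.

Lemma Cn_mult (n : nat) (f g : R -> R) : Cn n f -> Cn n g -> Cn n (fun x => f x * g x).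
Proof.
  revert f g. induction n as [|n IH]; intros f g Hf Hg; [exact I|].
  pose proof (Cn_weaken _ _ Hf) as Hf'. pose proof (Cn_weaken _ _ Hg) as Hg'.
  destruct Hf as [df [Df Cf]], Hg as [dg [Dg Cg]].
  exists (fun x => df x * g x + f x * dg x). split; [|apply Cn_plus; apply IH; assumption].
  intros x. apply @is_derive_mult; auto. intros; apply Rmult_comm.
Qed.

Lemma Cn_comp (n : nat) (f g : R -> R) : Cn n f -> Cn n g -> Cn n (fun x => f (g x)).
Proof.
  revert f g. induction n as [|n IH]; intros f g Hf Hg; [exact I|].
  pose proof (Cn_weaken _ _ Hg) as Hg'.
  destruct Hf as [df [Df Cf]], Hg as [dg [Dg Cg]].
  exists (fun x => dg x * df (g x)). split.
  - intros x. apply @is_derive_comp; auto.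
  - apply Cn_mult; [exact Cg|]. apply IH; assumption.
Qed.

Lemma Cn_inv (n : nat) (f : R -> R) : (forall x, f x <> 0) -> Cn n f -> Cn n (fun x => / f x).
Proof.
  intros N. induction n as [|n IH]; intros Hf; [exact I|].
  pose proof (IH (Cn_weaken _ _ Hf)) as Hi.
  destruct Hf as [df [Df Cf]].
  exists (fun x => (-1 * df x) * (/ f x * / f x)). split.
  - intros x. replace (-1 * df x * (/ f x * / f x)) with (- df x / f x ^ 2)
      by (field; apply N). apply is_derive_inv; auto.
  - repeat apply Cn_mult; auto using Cn_const.
Qed.

Lemma smooth_const (c : R) : smooth (fun _ => c).
Proof. apply smooth_Cn. intros n. apply Cn_const. Qed.

Lemma smooth_id : smooth (fun x => x).
Proof. apply smooth_Cn, Cn_id. Qed.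

Lemma smooth_plus (f g : R -> R) : smooth f -> smooth g -> smooth (fun x => f x + g x).
Proof. rewrite !smooth_Cn. intros Hf Hg n. apply Cn_plus; auto. Qed.

Lemma smooth_mult (f g : R -> R) : smooth f -> smooth g -> smooth (fun x => f x * g x).
Proof. rewrite !smooth_Cn. intros Hf Hg n. apply Cn_mult; auto. Qed.

Lemma smooth_ext (f g : R -> R) : (forall x, f x = g x) -> smooth f -> smooth g.
Proof. intros E H. replace g with f; [exact H|]. apply functional_extensionality, E. Qed.

Lemma smooth_opp (f : R -> R) : smooth f -> smooth (fun x => - f x).
Proof.
  intros H. apply smooth_ext with (fun x => (-1) * f x); [intros; ring|].
  apply smooth_mult; [apply smooth_const|exact H].
Qed.

Lemma smooth_minus (f g : R -> R) : smooth f -> smooth g -> smooth (fun x => f x - g x).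
Proof. intros Hf Hg. exact (smooth_plus _ _ Hf (smooth_opp _ Hg)). Qed.

Lemma smooth_comp (f g : R -> R) : smooth f -> smooth g -> smooth (fun x => f (g x)).
Proof. rewrite !smooth_Cn. intros Hf Hg n. apply Cn_comp; auto. Qed.

Lemma smooth_inv (f : R -> R) : (forall x, f x <> 0) -> smooth f -> smooth (fun x => / f x).
Proof. rewrite !smooth_Cn. intros N Hf n. apply Cn_inv; auto. Qed.

Lemma is_derive_continuity (f : R -> R) (x d : R) : is_derive f x d -> continuity_pt f x.
Proof.
  intros H. apply continuity_pt_filterlim. apply (ex_derive_continuous f). exists d. exact H.
Qed.

Lemma smooth_continuity (f : R -> R) : smooth f -> continuity f.
Proof. intros H x. exact (is_derive_continuity _ _ _ (smooth_is_derive f x H)). Qed.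

Lemma smooth_MVT (f : R -> R) (a b : R) : smooth f ->
  exists c, Rmin a b <= c <= Rmax a b /\ f b - f a = Derive f c * (b - a).
Proof.
  intros H. apply MVT_gen; intros x _; [apply smooth_is_derive, H|apply smooth_continuity, H].
Qed.

(** The lower bound makes [f] stretch distances by at least [c]: this gives injectivity,
    surjectivity, and an inverse that is Lipschitz, hence differentiable. *)
Lemma diffeo_plus_intro (f : R -> R) (c : R) :
  smooth f -> 0 < c -> (forall x, c <= Derive f x) -> diffeo_plus f.
Proof.
  intros Sf Hc Hd.
  assert (Hexp : forall x y, x <= y -> c * (y - x) <= f y - f x).
  { intros x y Hxy. destruct (smooth_MVT f x y Sf) as [z [_ E]]. rewrite E.
    apply Rmult_le_compat_r; [lra|apply Hd]. }
  assert (Hinc : forall x y, x < y -> f x < f y).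
  { intros x y Hxy. specialize (Hexp x y (Rlt_le _ _ Hxy)).
    pose proof (Rmult_lt_0_compat _ _ Hc (proj2 (Rlt_0_minus _ _) Hxy)). lra. }
  assert (Hinj : forall x y, f x = f y -> x = y).
  { intros x y E. destruct (Rtotal_order x y) as [L|[L|L]]; [|exact L|];
    apply Hinc in L; lra. }
  assert (Hsur : forall y, exists x, f x = y).
  { intros y. set (M := Rabs (y - f 0) / c).
    assert (HM : c * M = Rabs (y - f 0)) by (unfold M; field; lra).
    assert (HM0 : 0 <= M) by (unfold M; apply Rdiv_le_0_compat; [apply Rabs_pos|exact Hc]).
    pose proof (Hexp 0 M HM0) as H1. assert (Hm0 : - M <= 0) by lra.
    pose proof (Hexp (- M) 0 Hm0) as H2.
    pose proof (Rle_abs (y - f 0)). pose proof (Rle_abs (- (y - f 0))) as H4.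
    rewrite Rabs_Ropp in H4.
    destruct (IVT_gen f (- M) M y (smooth_continuity f Sf)) as [x [_ E]]; [|exists x; exact E].
    rewrite Rmin_left, Rmax_right by lra. lra. }
  destruct (choice (fun y x => f x = y) Hsur) as [g Hg].
  assert (Hgf : forall x, g (f x) = x) by (intros x; apply Hinj, Hg).
  assert (Hgl : forall y k, Rabs (g (y + k) - g y) * c <= Rabs k).
  { intros y k. assert (Ek : k = f (g (y + k)) - f (g y)) by (rewrite !Hg; ring).
    rewrite Ek at 2.
    destruct (Rle_dec (g y) (g (y + k))) as [L|L].
    - rewrite Rabs_pos_eq by lra. eapply Rle_trans; [|apply Rle_abs].
      specialize (Hexp _ _ L). lra.
    - assert (L' : g (y + k) <= g y) by lra. rewrite Rabs_minus_sym, Rabs_pos_eq by lra.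
      rewrite Rabs_minus_sym. eapply Rle_trans; [|apply Rle_abs].
      specialize (Hexp _ _ L'). lra. }
  assert (Dg : forall y, is_derive g y (/ Derive f (g y))).
  { intros y. apply is_derive_Reals. intros eps Heps.
    assert (Hp : 0 < Derive f (g y)) by (eapply Rlt_le_trans; [exact Hc|apply Hd]).
    pose proof (proj1 (is_derive_Reals _ _ _) (smooth_is_derive f (g y) Sf)) as Df.
    (* The factor [c * Derive f (g y)] compensates the bound [Hq] on [u / (k * Derive f (g y))]. *)
    destruct (Df (eps * c * Derive f (g y))) as [del Hdel].
    { repeat apply Rmult_lt_0_compat; assumption. }
    assert (Hdc : 0 < del * c) by (apply Rmult_lt_0_compat; [apply cond_pos|exact Hc]).
    exists (mkposreal _ Hdc). intros k Hk0 Hk. simpl in Hk.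
    set (u := g (y + k) - g y).
    assert (Eu : f (g y + u) - f (g y) = k).
    { unfold u. replace (g y + (g (y + k) - g y)) with (g (y + k)) by ring.
      rewrite !Hg. ring. }
    assert (Hu0 : u <> 0).
    { intros E. apply Hk0. rewrite <- Eu, E, Rplus_0_r. ring. }
    assert (Hul : Rabs u < del).
    { apply Rmult_lt_reg_r with c; [exact Hc|]. eapply Rle_lt_trans; [apply Hgl|exact Hk]. }
    specialize (Hdel u Hu0 Hul). rewrite Eu in Hdel.
    replace (u / k - / Derive f (g y))
      with (- (k / u - Derive f (g y)) * (u / (k * Derive f (g y)))).
    2: { field. repeat split; lra || assumption. }
    rewrite Rabs_mult, Rabs_Ropp.
    assert (Hq : Rabs (u / (k * Derive f (g y))) <= / (c * Derive f (g y))).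
    { unfold Rdiv. rewrite Rabs_mult, Rabs_inv, Rabs_mult, (Rabs_pos_eq (Derive f (g y))) by lra.
      apply Rmult_le_reg_r with (c * (Rabs k * Derive f (g y))).
      - pose proof (Rabs_pos_lt _ Hk0). repeat apply Rmult_lt_0_compat; assumption.
      - pose proof (Rabs_pos_lt _ Hk0). pose proof (Hgl y k) as Hl. fold u in Hl.
        replace (Rabs u * / (Rabs k * Derive f (g y)) * (c * (Rabs k * Derive f (g y))))
          with (Rabs u * c) by (field; lra).
        replace (/ (c * Derive f (g y)) * (c * (Rabs k * Derive f (g y))))
          with (Rabs k) by (field; lra). exact Hl. }
    eapply Rle_lt_trans; [apply Rmult_le_compat_l; [apply Rabs_pos|exact Hq]|].
    replace eps with (eps * c * Derive f (g y) * / (c * Derive f (g y))) by (field; lra).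
    apply Rmult_lt_compat_r; [|exact Hdel].
    apply Rinv_0_lt_compat, Rmult_lt_0_compat; assumption. }
  assert (Sg : smooth g).
  (* Bootstrapping: the derivative of [g] is [/ Derive f (g y)], so [n] levels of regularity of [g]
     yield level [n + 1]. *)
  { apply smooth_Cn. intros n. induction n as [|n IH]; [exact I|].
    exists (fun y => / Derive f (g y)). split; [exact Dg|].
    apply Cn_inv with (f := fun y => Derive f (g y)).
    - intros y. pose proof (Hd (g y)). lra.
    - apply Cn_comp; [|exact IH]. apply smooth_Cn, smooth_Derive, Sf. }
  split; [|exact Hinc]. split; [exact Sf|]. exists g. auto.
Qed.

(** * Taylor series of smooth functions *)

Lemma continuity_bigO0 (u : R -> R) : continuity_pt u 0 -> bigO 0 u.
Proof.
  intros H. apply continuity_pt_locally with (eps := mkposreal 1 Rlt_0_1) in H. simpl in H.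
  exists (Rabs (u 0) + 1). revert H. apply filter_imp. intros x Hx. simpl.
  pose proof (Rabs_triang_inv (u x) (u 0)). lra.
Qed.

(** The Lagrange remainder is controlled by local boundedness of the derivative of order [n + 1].
    [Pos] treats the right side; applied to [fun x => f (- x)] it gives the left side. *)
Lemma smooth_jet (f : R -> R) : smooth f -> jet f (T0 f).
Proof.
  assert (Pos : forall f, smooth f -> forall n, exists C e, 0 < e /\
            forall x, 0 < x < e -> Rabs (f x - peval (T0 f) n x) <= C * Rabs x ^ S n).
  { clear f. intros f Sf n.
    assert (Sn : continuity_pt (Derive_n f (S n)) 0)
      by (apply is_derive_continuity with (Derive (Derive_n f (S n)) 0);
          apply Derive_correct; exact (Sf (S (S n)) 0)).
    destruct (bigO_pos _ _ (continuity_bigO0 _ Sn)) as [C [e [HC [He K]]]].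
    exists (/ INR (Factorial.fact (S n)) * C), e. split; [exact He|].
    intros x Hx. destruct (Taylor_Lagrange f n 0 x) as [z [Hz E]]; [lra|intros; apply Sf|].
    pose proof (INR_fact_lt_0 (S n)) as Hf.
    rewrite E, !Rminus_0_r.
    replace (sum_f_R0 _ n) with (peval (T0 f) n x).
    2: { unfold peval, T0. apply sum_eq. intros k _. field. apply INR_fact_neq_0. }
    match goal with |- Rabs ?t <= _ =>
      replace t with (/ INR (Factorial.fact (S n)) * Derive_n f (S n) z * x ^ S n)
    end.
    2: { unfold Rdiv. ring. }
    rewrite !Rabs_mult, RPow_abs. apply Rmult_le_compat_r; [apply Rabs_pos|].
    rewrite (Rabs_pos_eq (/ _)) by (left; apply Rinv_0_lt_compat, Hf).
    apply Rmult_le_compat_l; [left; apply Rinv_0_lt_compat, Hf|].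
    specialize (K z). rewrite pow_O, Rmult_1_r in K. apply K.
    rewrite Rabs_pos_eq; lra. }
  intros Sf n. destruct (Pos f Sf n) as [C [e [He K]]].
  assert (Sm : smooth (fun x => f (- x))).
  { apply (smooth_comp f (fun x => - x)); [exact Sf|]. apply smooth_opp, smooth_id. }
  destruct (Pos _ Sm n) as [D [e' [He' L]]].
  apply (bigO_intro _ _ (Rmax C D) (Rmin e e')); [apply Rmin_pos; assumption|].
  intros x Hx.
  assert (Hp : 0 <= Rabs x ^ S n) by (apply pow_le, Rabs_pos).
  pose proof (Rmin_l e e'). pose proof (Rmin_r e e').
  destruct (Rtotal_order x 0) as [N|[Z|P]].
  - rewrite Rabs_left in Hx by exact N.
    eapply Rle_trans; [|apply Rmult_le_compat_r; [exact Hp|apply Rmax_r]].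
    specialize (L (- x)). rewrite Ropp_involutive, Rabs_Ropp in L.
    replace (peval (T0 f) n x) with (peval (T0 (fun x => f (- x))) n (- x)); [apply L; lra|].
    unfold peval, T0. apply sum_eq. intros k _. rewrite Derive_n_comp_opp.
    + rewrite Ropp_0. replace (- x) with (-1 * x) by ring. rewrite Rpow_mult_distr.
      replace (x ^ k) with ((-1) ^ k * (-1) ^ k * x ^ k) at 2.
      * field. apply INR_fact_neq_0.
      * rewrite <- Rpow_mult_distr. replace (-1 * -1) with 1 by ring. rewrite pow1. ring.
    + apply filter_forall. intros y i _. apply Sf.
  - subst x. rewrite Rabs_R0, pow_i, Rmult_0_r by lia.
    replace (peval (T0 f) n 0) with (f 0); [rewrite Rminus_diag, Rabs_R0; lra|].
    unfold peval. clear. induction n as [|n IH].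
    + unfold T0. simpl. field.
    + rewrite tech5, <- IH, pow_i by lia. ring.
  - rewrite Rabs_pos_eq in Hx by lra.
    eapply Rle_trans; [|apply Rmult_le_compat_r; [exact Hp|apply Rmax_l]].
    apply K. lra.
Qed.

Lemma T0_0 (f : R -> R) : T0 f 0%nat = f 0.
Proof. unfold T0. simpl. field. Qed.

Lemma T0_Derive (f : R -> R) (n : nat) : T0 (Derive f) n = INR (S n) * T0 f (S n).
Proof.
  unfold T0. rewrite <- Derive_n_S, fact_simpl, mult_INR. field.
  split; [apply INR_fact_neq_0|apply not_0_INR; lia].
Qed.

Lemma T0_ext_loc (f g : R -> R) :
  smooth f -> smooth g -> locally 0 (fun x => f x = g x) -> T0 f = T0 g.
Proof.
  intros Sf Sg H. apply (jet_unique g); [|apply smooth_jet, Sg].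
  exact (jet_ext_loc _ _ _ H (smooth_jet f Sf)).
Qed.

Lemma T0_comp (f g : R -> R) : smooth f -> smooth g -> g 0 = 0 ->
  T0 (fun x => f (g x)) = fps_comp (T0 f) (T0 g).
Proof.
  intros Sf Sg H. apply (jet_unique (fun x => f (g x))).
  - apply smooth_jet, smooth_comp; assumption.
  - apply jet_comp; [rewrite T0_0; exact H|apply smooth_jet, Sf|apply smooth_jet, Sg].
Qed.

Lemma T0_id : T0 (fun x => x) = fps_X.
Proof. apply (jet_unique (fun x => x)); [apply smooth_jet, smooth_id|exact jet_X]. Qed.

Lemma T0_minus (f g : R -> R) (n : nat) : smooth f -> smooth g ->
  T0 (fun x => f x - g x) n = T0 f n - T0 g n.
Proof.
  intros Sf Sg. change (T0 f n - T0 g n) with ((fun n => T0 f n - T0 g n) n).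
  apply (f_equal (fun s : fps => s n)). apply (jet_unique (fun x => f x - g x)).
  - apply smooth_jet, smooth_minus; assumption.
  - apply jet_minus; apply smooth_jet; assumption.
Qed.

Lemma T0_minus_id (f : R -> R) (n : nat) :
  smooth f -> T0 (fun x => f x - x) n = T0 f n - fps_X n.
Proof.
  intros Sf. rewrite <- T0_id. apply (T0_minus f (fun x => x)); [exact Sf|exact smooth_id].
Qed.

Lemma smooth_lead (f : R -> R) (n : nat) :
  smooth f -> (forall k, (k < n)%nat -> T0 f k = 0) -> lead n (T0 f n) f.
Proof. intros Sf H. apply jet_lead; [apply smooth_jet, Sf|exact H]. Qed.

Lemma smooth_lead_1 (f : R -> R) : smooth f -> f 0 = 0 -> lead 1 (T0 f 1%nat) f.
Proof.
  intros Sf H. apply smooth_lead; [exact Sf|]. intros k Hk.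
  replace k with 0%nat by lia. rewrite T0_0. exact H.
Qed.

Lemma smooth_lead_Derive (f : R -> R) (n : nat) :
  smooth f -> (forall k, (k < S n)%nat -> T0 f k = 0) ->
  lead n (INR (S n) * T0 f (S n)) (Derive f).
Proof.
  intros Sf H. rewrite <- T0_Derive. apply smooth_lead; [apply smooth_Derive, Sf|].
  intros k Hk. rewrite T0_Derive, H by lia. ring.
Qed.

(** [T0 k] shows that the specification behind the choice in [fps_inv] is satisfiable; right
    cancellation by [T0 h] then identifies the chosen series with it. *)
Lemma T0_inverse (h k : R -> R) : smooth h -> smooth k -> h 0 = 0 ->
  (forall x, k (h x) = x) -> (forall x, h (k x) = x) -> fps_inv (T0 h) = T0 k.
Proof.
  intros Sh Sk H0 Hkh Hhk.
  assert (K0 : k 0 = 0) by (rewrite <- H0 at 1; apply Hkh).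
  assert (Ekh : fps_comp (T0 k) (T0 h) = fps_X).
  { rewrite <- T0_comp, <- T0_id by assumption. f_equal.
    apply functional_extensionality, Hkh. }
  assert (Ehk : fps_comp (T0 h) (T0 k) = fps_X).
  { rewrite <- T0_comp, <- T0_id by assumption. f_equal.
    apply functional_extensionality, Hhk. }
  assert (Hs : exists b : fps,
    b 0%nat = 0 /\ fps_comp (T0 h) b = fps_X /\ fps_comp b (T0 h) = fps_X).
  { exists (T0 k). split; [rewrite T0_0; exact K0|auto]. }
  pose proof (epsilon_spec (inhabits fps_X) _ Hs) as [_ [_ E]].
  apply (fps_comp_cancel_r _ _ (T0 h)).
  - rewrite T0_0. exact H0.
  (* The coefficient of [X] in [k o h] is the product of the two slopes and equals 1, so the slope
     of [h] is nonzero. *)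
  - intros Z. pose proof (f_equal (fun s : fps => s 1%nat) Ekh) as E1.
    unfold fps_comp in E1. simpl in E1. unfold fps_mul, fps_one, fps_X in E1. simpl in E1.
    rewrite Z in E1. lra.
  - transitivity fps_X; [exact E|symmetry; exact Ekh].
Qed.

(** * Formal square roots of a non-identity series *)

(** By the mean value theorem the difference is [Derive u (xi x) * (y x - z x)], and [xi], squeezed
    between [y] and [z], inherits their slope [l]. *)
Lemma lead_comp_diff (u y z : R -> R) (k n : nat) (c d l : R) :
  smooth u -> lead k d (Derive u) -> lead 1 l y -> lead 1 l z ->
  lead n c (fun x => y x - z x) ->
  lead (k + n) (d * l ^ k * c) (fun x => u (y x) - u (z x)).
Proof.
  intros Su Hd Hy Hz Hyz.
  destruct (choice (fun x t => Rmin (z x) (y x) <= t <= Rmax (z x) (y x) /\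
              u (y x) - u (z x) = Derive u t * (y x - z x))) as [xi Hxi].
  { intros x. apply smooth_MVT, Su. }
  assert (Lxi : lead 1 l xi).
  { destruct Hy as [C HC], Hz as [D HD]. exists (C + D).
    generalize (filter_and _ _ HC HD). apply filter_imp. intros x [A B].
    destruct (Hxi x) as [[P Q] _].
    apply Rabs_le_between in A. apply Rabs_le_between in B. apply Rabs_le_between.
    rewrite Rmult_plus_distr_r.
    unfold Rmin in P. unfold Rmax in Q. destruct (Rle_dec (z x) (y x)); lra. }
  apply lead_ext with (fun x => Derive u (xi x) * (y x - z x)).
  { intros x. symmetry. apply Hxi. }
  apply lead_mult; [|exact Hyz]. apply lead_comp; assumption.
Qed.

(** Differentiability of the inverse excludes slope 0, and monotonicity excludes positive slope. *)
Lemma diffeo_minus_slope (f : R -> R) : diffeo_minus f -> f 0 = 0 -> T0 f 1%nat < 0.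
Proof.
  intros [[Sf [i [Si [Hif Hfi]]]] Hdec] F0.
  assert (I0 : i 0 = 0) by (rewrite <- F0 at 1; apply Hif).
  pose proof (smooth_lead_1 f Sf F0) as Lf. pose proof (smooth_lead_1 i Si I0) as Li.
  assert (E : T0 i 1%nat * T0 f 1%nat ^ 1 = 1).
  { apply (lead_unique 1) with (fun x => x).
    - eapply lead_ext; [|exact (lead_comp _ _ _ _ _ Li Lf)]. exact Hif.
    - eapply lead_ext; [|exact (lead_monom 1 1)]. intros; simpl; ring. }
  destruct (Rtotal_order (T0 f 1%nat) 0) as [N|[Z|P]]; [exact N| |].
  - rewrite Z in E. simpl in E. lra.
  - destruct (lead_pos _ _ _ P Lf) as [e [He H]]. exfalso.
    assert (Hx : 0 < e / 2 < e) by lra. specialize (H _ Hx).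
    assert (f (e / 2) < f 0) by (apply Hdec; lra).
    assert (0 < T0 f 1%nat / 2 * (e / 2) ^ 1) by (apply Rmult_lt_0_compat; [|apply pow_lt]; lra).
    lra.
Qed.

Lemma square_slope (f : R -> R) : smooth f -> f 0 = 0 ->
  T0 (fun x => f (f x)) 1%nat = T0 f 1%nat * T0 f 1%nat.
Proof.
  intros Sf F0. apply (lead_unique 1) with (fun x => f (f x)).
  - apply smooth_lead_1; [apply smooth_comp; assumption|rewrite !F0; reflexivity].
  - pose proof (smooth_lead_1 f Sf F0) as Lf.
    pose proof (lead_comp _ _ _ _ _ Lf Lf) as H. simpl in H. rewrite Rmult_1_r in H. exact H.
Qed.

Lemma root_slope (f : R -> R) : diffeo_minus f -> f 0 = 0 ->
  T0 (fun x => f (f x)) 1%nat = 1 -> T0 f 1%nat = -1.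
Proof.
  intros Df F0 H. pose proof (diffeo_minus_slope f Df F0) as N.
  destruct Df as [[Sf _] _]. rewrite square_slope in H by assumption. nra.
Qed.

Lemma pow_eq_1 (x : R) (n : nat) : 0 < x -> x ^ S n = 1 -> x = 1.
Proof.
  intros Hx E. destruct (Rtotal_order x 1) as [L|[L|L]]; [|exact L|]; exfalso.
  - pose proof (pow_lt_1_compat x (S n)) as H. assert (0 <= x ^ S n < 1) by (apply H; lra || lia). lra.
  - pose proof (Rlt_pow_R1 x (S n) L). assert (1 < x ^ S n) by (apply H; lia). lra.
Qed.

(* If [g - f = c x^n + ...] with [c <> 0], comparing [f o f] with [g o g] forces slope [-1]
   and [n] even; then, writing [f o f = x + a x^(p+1) + ...], comparing
   [f o (f o f) = (f o f) o f] with the same identity for [g] gives [n = (-1)^p (p + 1)]. *)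
Lemma square_root_jet_unique (f g : R -> R) :
  diffeo_minus f -> diffeo_minus g -> f 0 = 0 -> g 0 = 0 ->
  (forall x, f (f x) = g (g x)) ->
  T0 (fun x => f (f x)) <> fps_X -> T0 f = T0 g.
Proof.
  intros Df Dg F0 G0 E NX. apply NNPP. intros N.
  pose proof (diffeo_minus_slope f Df F0) as Nf.
  pose proof (diffeo_minus_slope g Dg G0) as Ng.
  destruct Df as [[Sf _] _], Dg as [[Sg _] _].
  assert (EF : (fun x => f (f x)) = (fun x => g (g x)))
    by (apply functional_extensionality, E).
  (* The two slopes have the same square and are both negative. *)
  assert (Esl : T0 g 1%nat = T0 f 1%nat).
  { pose proof (square_slope f Sf F0) as H1. pose proof (square_slope g Sg G0) as H2.
    rewrite <- EF, H1 in H2. nra. }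
  set (mu := - T0 f 1%nat). assert (Hmu : 0 < mu) by (unfold mu; lra).
  assert (Lf : lead 1 (- mu) f).
  { unfold mu. rewrite Ropp_involutive. apply smooth_lead_1; assumption. }
  assert (Lg : lead 1 (- mu) g).
  { unfold mu. rewrite Ropp_involutive, <- Esl. apply smooth_lead_1; assumption. }
  assert (N' : T0 g <> T0 f) by (intros H; apply N; symmetry; exact H).
  destruct (fps_neq_first _ _ N') as [n [Hc Hn]].
  set (w := fun x => g x - f x).
  assert (Sw : smooth w) by (apply smooth_minus; assumption).
  assert (Tw : forall k, T0 w k = T0 g k - T0 f k) by (intros; apply T0_minus; assumption).
  set (c := T0 w n). assert (Hc' : c <> 0) by (unfold c; rewrite Tw; exact Hc).
  assert (Hw0 : forall k, (k < n)%nat -> T0 w k = 0) by (intros k Hk; rewrite Tw; auto).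
  assert (Hn2 : (2 <= n)%nat).
  { destruct n as [|[|n]]; [| |lia]; exfalso; apply Hc.
    - rewrite !T0_0. lra.
    - rewrite Esl. lra. }
  assert (Lw : lead n c w) by (apply smooth_lead; assumption).
  (* The coefficient of [x ^ n] in [(f o g - f o f) + w o g], which is [g o g - f o f = 0]. *)
  assert (H1 : - mu * c + c * (- mu) ^ n = 0).
  { apply (lead_unique n) with (fun x => (f (g x) - f (f x)) + w (g x)).
    - apply lead_plus; [|apply lead_comp; assumption].
      replace (- mu * c) with (- mu * (- mu) ^ 0 * c) by (simpl; ring).
      apply (lead_comp_diff f g f 0 n c (- mu) (- mu)); try assumption.
      unfold mu. rewrite Ropp_involutive.
      replace (T0 f 1%nat) with (T0 (Derive f) 0%nat) by (rewrite T0_Derive; simpl; ring).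
      apply smooth_lead; [apply smooth_Derive, Sf|intros; lia].
    - apply lead_zero. apply bigO_ext with (fun _ => 0); [|apply bigO_zero].
      intros x. unfold w. rewrite <- E. ring. }
  assert (Hpow : (- mu) ^ n = mu).
  { apply Rmult_eq_reg_l with c; [|exact Hc']. lra. }
  destruct (Nat.Even_or_Odd n) as [[m Hm]|[m Hm]].
  2: { assert (Hneg : (- mu) ^ n < 0); [|lra].
       rewrite Hm, Nat.add_1_r, <- tech_pow_Rmult, pow_Rsqr.
       assert (0 < (Rsqr (- mu)) ^ m) by (apply pow_lt, Rlt_0_sqr; lra). nra. }
  (* With [n] even, [mu ^ n = mu], that is [mu ^ (n - 1) = 1], and [n - 1] is positive. *)
  assert (Hmu1 : mu = 1).
  { destruct m as [|m]; [lia|]. apply pow_eq_1 with (2 * m)%nat; [exact Hmu|].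
    rewrite Hm in Hpow. rewrite pow_Rsqr, <- Rsqr_neg, <- pow_Rsqr in Hpow.
    replace (2 * S m)%nat with (S (S (2 * m))) in Hpow by lia.
    change (mu * mu ^ S (2 * m) = mu) in Hpow.
    apply Rmult_eq_reg_l with mu; lra. }
  replace (- mu) with (-1) in Lf, Lg by lra. clear H1 Hpow.
  set (F := fun x => f (f x)). fold F in NX.
  assert (SF : smooth F) by exact (smooth_comp f f Sf Sf).
  set (D := fun x => F x - x).
  assert (SD : smooth D) by exact (smooth_minus F (fun x => x) SF smooth_id).
  assert (TD : forall k, T0 D k = T0 F k - fps_X k).
  { intros k. apply T0_minus_id, SF. }
  destruct (fps_neq_first _ _ NX) as [q [Ha Hq]].
  (* [F] agrees with the identity in degrees 0 and 1, as its slope is [(-1)^2]; so its first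
     deviation has degree at least 2. *)
  destruct q as [|[|p]].
  { apply Ha. rewrite T0_0. unfold F, fps_X. rewrite !F0. simpl. ring. }
  { apply Ha. unfold F. rewrite square_slope by assumption.
    replace (T0 f 1%nat) with (-1) by (unfold mu in Hmu1; lra). unfold fps_X. simpl. ring. }
  set (a := T0 D (S (S p))). assert (Ha' : a <> 0) by (unfold a; rewrite TD; exact Ha).
  assert (HD0 : forall k, (k < S (S p))%nat -> T0 D k = 0) by (intros k Hk; rewrite TD; auto).
  assert (LD : lead (S (S p)) a D) by (apply smooth_lead; assumption).
  assert (Lid : lead 1 1 (fun x => x)).
  { eapply lead_ext; [|exact (lead_monom 1 1)]. intros; simpl; ring. }
  assert (LF : lead 1 1 F).
  { pose proof (lead_comp _ _ _ _ _ Lf Lf) as H.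
    replace (-1 * (-1) ^ 1) with 1 in H by ring. exact H. }
  pose proof (lead_comp_diff D g f (S p) n c _ (-1) SD (smooth_lead_Derive D _ SD HD0)
                Lg Lf Lw) as L1.
  destruct n as [|n]; [lia|].
  pose proof (lead_comp_diff w F (fun x => x) n (S (S p)) a _ 1 Sw
                (smooth_lead_Derive w _ Sw Hw0) LF Lid LD) as L2.
  replace (n + S (S p))%nat with (S p + S n)%nat in L2 by lia.
  (* Since [F] commutes with [f] and [g], [D o g - D o f = w o F - w]; both sides are expanded in
     degree [S p + S n]. *)
  assert (EQ : INR (S (S p)) * a * (-1) ^ S p * c = INR (S n) * c * 1 ^ n * a).
  { eapply lead_unique; [exact L1|]. eapply lead_ext; [|exact L2].
    intros x. unfold D, w, F. rewrite (E (g x)), <- (E x). ring. }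
  rewrite pow1 in EQ.
  assert (EQ' : INR (S (S p)) * (-1) ^ S p = INR (S n)).
  { apply Rmult_eq_reg_r with (a * c); [|apply Rmult_integral_contrapositive; auto]. lra. }
  destruct (Nat.Even_or_Odd (S p)) as [[r Hr]|[r Hr]].
  - rewrite Hr, pow_1_even, Rmult_1_r in EQ'. apply INR_eq in EQ'. lia.
  - rewrite Hr, Nat.add_1_r, pow_1_odd in EQ'.
    pose proof (pos_INR (S (S (2 * r)))). pose proof (lt_0_INR (S n)).
    assert (0 < INR (S n)) by (apply H0; lia). lra.
Qed.

(** * Centralizers of flat diffeomorphisms *)

(* With [D = F - id] and [y = h x], commutation gives [D y = h' (xi) * D x], so for large [K] the
   quotient [|D y| / y ^ K] does not decrease when [y] is replaced by [k y]; along the orbit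
   [k^n y], which tends to [0], flatness of [D] forces it to vanish. *)
Lemma expanding_flat_commuting (h k F : R -> R) (p : nat) (c C e : R) :
  smooth h -> 0 < c -> 0 <= C -> 0 < e ->
  (forall x, 0 < x < e -> x + c * x ^ S p <= h x) ->
  (forall x, 0 < x < e -> Rabs (Derive h x) <= 1 + C * x ^ p) ->
  (forall x, h (k x) = x) -> (forall x, k (h x) = x) -> k 0 = 0 ->
  (forall x y, x < y -> k x < k y) ->
  (forall x, h (F x) = F (h x)) -> (forall n, bigO n (fun x => F x - x)) ->
  exists d, 0 < d /\ forall x, 0 < x < d -> F x = x.
Proof.
  intros Sh Hc HC He Hexp Hder Hhk Hkh K0 Kinc Hcom Hflat.
  (* With this [K], Bernoulli's inequality gives [(1 + c * x ^ p) ^ K >= 1 + C * (2 * x) ^ p], the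
     bound on [Derive h] at points up to [2 * x]. *)
  assert (HK : exists K, C * 2 ^ p <= INR K * c).
  { destruct (INR_unbounded (C * 2 ^ p / c)) as [K HK]. exists K.
    replace (C * 2 ^ p) with (C * 2 ^ p / c * c) by (field; lra).
    apply Rmult_le_compat_r; lra. }
  destruct HK as [K HK].
  destruct (bigO_pos _ _ (Hflat 2%nat)) as [C2 [e2 [HC2 [He2 B2]]]].
  destruct (bigO_pos _ _ (Hflat (S K))) as [C3 [e3 [HC3 [He3 B3]]]].
  (* The bound [/ (2 * C2)] gives [|F x - x| <= x / 2], so mean value points lie in
     [[x / 2, 2 * x]]; the bound [e / 2] keeps them below [e]. *)
  set (d := Rmin (e / 2) (Rmin e2 (Rmin e3 (/ (2 * C2))))).
  assert (Hd : 0 < d).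
  { unfold d. repeat apply Rmin_pos; try lra. apply Rinv_0_lt_compat; lra. }
  assert (Hd1 : d <= e / 2) by apply Rmin_l.
  assert (Hd2 : d <= e2) by (eapply Rle_trans; [apply Rmin_r|apply Rmin_l]).
  assert (Hd3 : d <= e3)
    by (eapply Rle_trans; [apply Rmin_r|eapply Rle_trans; [apply Rmin_r|apply Rmin_l]]).
  assert (Hd4 : d <= / (2 * C2))
    by (eapply Rle_trans; [apply Rmin_r|eapply Rle_trans; [apply Rmin_r|apply Rmin_r]]).
  assert (Hkpos : forall y, 0 < y -> 0 < k y) by (intros y Hy; rewrite <- K0; apply Kinc, Hy).
  assert (Hklt : forall y, 0 < y < d -> k y + c * k y ^ S p <= y).
  { intros y Hy. rewrite <- (Hhk y) at 3. apply Hexp. split; [apply Hkpos; lra|].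
    (* Hence [y < h (e / 2)] and [k y < e / 2], so the expansion bound is available at [k y]. *)
    assert (Hh : e / 2 <= h (e / 2)).
    { assert (H : 0 < e / 2 < e) by lra. specialize (Hexp _ H).
      assert (0 <= c * (e / 2) ^ S p) by (apply Rmult_le_pos; [|apply pow_le]; lra). lra. }
    assert (k y < k (h (e / 2))) by (apply Kinc; lra). rewrite Hkh in H. lra. }
  assert (Hksm : forall y, 0 < y < d -> 0 < k y < d).
  { intros y Hy. pose proof (Hklt y Hy) as H. pose proof (Hkpos y (proj1 Hy)) as H'. split; [exact H'|].
    assert (0 < c * k y ^ S p) by (apply Rmult_lt_0_compat; [lra|apply pow_lt, H']). lra. }
  assert (Hstep : forall y, 0 < y < d ->
    Rabs (F y - y) * k y ^ K <= y ^ K * Rabs (F (k y) - k y)).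
  { intros y Hy. set (x := k y). assert (Hx : 0 < x < d) by apply Hksm, Hy.
    assert (Exy : h x = y) by apply Hhk.
    assert (HD : Rabs (F x - x) <= x / 2).
    { specialize (B2 x). rewrite (Rabs_pos_eq x) in B2 by lra.
      eapply Rle_trans; [apply B2; lra|]. simpl.
      assert (H : C2 * x <= / 2).
      { replace (/ 2) with (C2 * / (2 * C2)) by (field; lra). apply Rmult_le_compat_l; lra. }
      replace (C2 * (x * (x * 1))) with (C2 * x * x) by ring.
      replace (x / 2) with (/ 2 * x) by field. apply Rmult_le_compat_r; lra. }
    destruct (smooth_MVT h x (F x) Sh) as [t [Ht E]].
    apply Rabs_le_between in HD.
    assert (Ht' : x / 2 <= t <= 2 * x).
    { unfold Rmin, Rmax in Ht. destruct (Rle_dec x (F x)); lra. }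
    assert (Hte : 0 < t < e) by lra.
    rewrite Hcom, Exy in E. rewrite E, Rabs_mult.
    assert (Hp : 0 < x ^ p) by (apply pow_lt; lra).
    assert (HpK : 0 < x ^ K) by (apply pow_lt; lra).
    assert (H1 : Rabs (Derive h t) <= 1 + INR K * (c * x ^ p)).
    { eapply Rle_trans; [apply Hder, Hte|]. apply Rplus_le_compat_l.
      assert (t ^ p <= 2 ^ p * x ^ p) by (rewrite <- Rpow_mult_distr; apply pow_incr; lra).
      apply Rle_trans with (C * (2 ^ p * x ^ p)); [apply Rmult_le_compat_l; lra|].
      rewrite <- !Rmult_assoc. apply Rmult_le_compat_r; lra. }
    assert (H2 : x ^ K * (1 + INR K * (c * x ^ p)) <= y ^ K).
    { apply Rle_trans with (x ^ K * (1 + c * x ^ p) ^ K).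
      - apply Rmult_le_compat_l; [lra|]. apply poly, Rmult_lt_0_compat; assumption.
      - rewrite <- Rpow_mult_distr. apply pow_incr. split.
        + assert (0 < c * x ^ p) by (apply Rmult_lt_0_compat; assumption).
          apply Rmult_le_pos; lra.
        + pose proof (Hklt y Hy) as H. fold x in H. simpl in H. lra. }
    apply Rle_trans with (x ^ K * (1 + INR K * (c * x ^ p)) * Rabs (F x - x)).
    2: { apply Rmult_le_compat_r; [apply Rabs_pos|exact H2]. }
    replace (Rabs (Derive h t) * Rabs (F x - x) * x ^ K)
      with (x ^ K * Rabs (Derive h t) * Rabs (F x - x)) by ring.
    apply Rmult_le_compat_r; [apply Rabs_pos|]. apply Rmult_le_compat_l; lra. }
  exists d. split; [exact Hd|]. intros y0 Hy0. apply NNPP. intros N.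
  assert (HD0 : 0 < Rabs (F y0 - y0)) by (apply Rabs_pos_lt; lra).
  assert (Hy0K : 0 < y0 ^ K) by (apply pow_lt; lra).
  set (r := Rabs (F y0 - y0) / y0 ^ K).
  assert (Hr : 0 < r) by (apply Rdiv_lt_0_compat; assumption).
  (* Flatness of order [K + 1] keeps points with quotient at least [r] away from 0. *)
  assert (Heta : forall y, 0 < y < d -> r * y ^ K <= Rabs (F y - y) -> r / C3 <= y).
  { intros y Hy H. assert (Hp : 0 < y ^ K) by (apply pow_lt; lra).
    specialize (B3 y). rewrite (Rabs_pos_eq y) in B3 by lra.
    assert (Hb : r * y ^ K <= C3 * y * y ^ K).
    { eapply Rle_trans; [exact H|]. eapply Rle_trans; [apply B3; lra|]. simpl. lra. }
    apply Rmult_le_reg_r in Hb; [|exact Hp].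
    apply Rmult_le_reg_l with C3; [exact HC3|].
    replace (C3 * (r / C3)) with r by (field; lra). exact Hb. }
  (* A lower bound on the decrease [y - k y] while the orbit stays above [r / C3]; finitely many
     steps then push it below 0. *)
  set (s := c * (r / C3) ^ S p).
  assert (Heta0 : 0 < r / C3) by (apply Rdiv_lt_0_compat; assumption).
  assert (Hs : 0 < s) by (apply Rmult_lt_0_compat; [exact Hc|apply pow_lt, Heta0]).
  assert (Horb : forall n, exists y,
            0 < y < d /\ r * y ^ K <= Rabs (F y - y) /\ y <= y0 - INR n * s).
  { induction n as [|n [y [Hy [H1 H2]]]].
    - exists y0. split; [exact Hy0|]. split; [|simpl; lra].
      unfold r. right. field. lra.
    - exists (k y). pose proof (Hksm y Hy) as Hk. split; [exact Hk|].
      assert (H3 : r * k y ^ K <= Rabs (F (k y) - k y)).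
      { assert (Hp : 0 < y ^ K) by (apply pow_lt; lra).
        apply Rmult_le_reg_l with (y ^ K); [exact Hp|].
        eapply Rle_trans; [|apply Hstep, Hy].
        replace (y ^ K * (r * k y ^ K)) with (r * y ^ K * k y ^ K) by ring.
        apply Rmult_le_compat_r; [apply pow_le; lra|exact H1]. }
      split; [exact H3|]. rewrite S_INR.
      pose proof (Hklt y Hy) as H4. pose proof (Heta _ Hk H3) as H5.
      assert (s <= c * k y ^ S p).
      { apply Rmult_le_compat_l; [lra|]. apply pow_incr. lra. }
      lra. }
  destruct (INR_unbounded (y0 / s)) as [n Hn]. destruct (Horb n) as [y [Hy [_ H]]].
  assert (y0 < INR n * s); [|lra].
  replace y0 with (y0 / s * s) by (field; lra). apply Rmult_lt_compat_r; assumption.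
Qed.

Lemma smooth_flat (F : R -> R) : smooth F -> T0 F = fps_X -> forall n, bigO n (fun x => F x - x).
Proof.
  intros SF EF n. apply lead_bigO with (T0 (fun x => F x - x) n). apply smooth_lead.
  - apply (smooth_minus F (fun x => x)); [exact SF|exact smooth_id].
  - intros k _. rewrite T0_minus_id, EF by exact SF. ring.
Qed.

(** A first deviation of degree [p + 1] moves points by order [x ^ S p] and perturbs [Derive h] by
    order [x ^ p], the two rates that [expanding_flat_commuting] balances. The case [p = 0] covers
    slope greater than 1. *)
Lemma lead_expanding_fix (h k F : R -> R) (p : nat) :
  smooth h -> 0 < T0 h (S p) - fps_X (S p) ->
  (forall j, (j < S p)%nat -> T0 h j - fps_X j = 0) ->
  (forall x, h (k x) = x) -> (forall x, k (h x) = x) -> k 0 = 0 ->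
  (forall x y, x < y -> k x < k y) ->
  smooth F -> T0 F = fps_X -> (forall x, h (F x) = F (h x)) ->
  exists d, 0 < d /\ forall x, 0 < x < d -> F x = x.
Proof.
  intros Sh Ha Hlow Hhk Hkh K0 Kinc SF EF Hcom.
  set (q := fun x => h x - x).
  assert (Sq : smooth q) by exact (smooth_minus h (fun x => x) Sh smooth_id).
  assert (Tq : forall n, T0 q n = T0 h n - fps_X n) by (intros n; apply T0_minus_id, Sh).
  assert (Hq : forall j, (j < S p)%nat -> T0 q j = 0) by (intros j Hj; rewrite Tq; auto).
  pose proof (smooth_lead q (S p) Sq Hq) as L. rewrite Tq in L.
  destruct (lead_pos _ _ _ Ha L) as [e1 [He1 H1]].
  pose proof (lead_bigO _ _ _ (smooth_lead_Derive q p Sq Hq)) as B.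
  destruct (bigO_pos _ _ B) as [C [e2 [HC [He2 H2]]]].
  apply (expanding_flat_commuting h k F p ((T0 h (S p) - fps_X (S p)) / 2) C (Rmin e1 e2));
    auto using smooth_flat.
  - lra.
  - lra.
  - apply Rmin_pos; assumption.
  - intros x [Hx Hx']. pose proof (Rmin_l e1 e2).
    assert (Hx1 : 0 < x < e1) by lra. specialize (H1 x Hx1). unfold q in H1. lra.
  - intros x [Hx Hx']. pose proof (Rmin_r e1 e2).
    specialize (H2 x). rewrite (Rabs_pos_eq x) in H2 by lra.
    assert (Hx2 : x < e2) by lra. specialize (H2 Hx2).
    assert (E : Derive h x = 1 + Derive q x).
    { assert (Eq : forall t, t + q t = h t) by (intros t; unfold q; ring).
      apply is_derive_unique. apply is_derive_ext with (fun t => t + q t).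
      - exact Eq.
      - apply @is_derive_plus; [apply @is_derive_id|apply smooth_is_derive, Sq]. }
    rewrite E. eapply Rle_trans; [apply Rabs_triang|]. rewrite Rabs_R1. lra.
Qed.

Lemma inverse_increasing (h k : R -> R) : (forall x y, x < y -> h x < h y) ->
  (forall x, h (k x) = x) -> forall x y, x < y -> k x < k y.
Proof.
  intros Hinc Hhk x y Hxy. destruct (Rlt_le_dec (k x) (k y)) as [L|[L|L]]; [exact L| |].
  - apply Hinc in L. rewrite !Hhk in L. lra.
  - apply (f_equal h) in L. rewrite !Hhk in L. lra.
Qed.

Lemma first_deviation (h : R -> R) : smooth h -> h 0 = 0 -> T0 h <> fps_X ->
  exists p, T0 h (S p) - fps_X (S p) <> 0 /\
    forall j, (j < S p)%nat -> T0 h j - fps_X j = 0.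
Proof.
  intros Sh H0 N. destruct (fps_neq_first _ _ N) as [[|p] [Hp Hlow]].
  - exfalso. apply Hp. rewrite T0_0, H0. unfold fps_X. simpl. ring.
  - exists p. auto.
Qed.

Lemma lead_contracting (h : R -> R) (p : nat) :
  smooth h -> T0 h (S p) - fps_X (S p) < 0 ->
  (forall j, (j < S p)%nat -> T0 h j - fps_X j = 0) ->
  exists e, 0 < e /\ forall x, 0 < x < e -> h x < x.
Proof.
  intros Sh Ha Hlow.
  assert (L : lead (S p) (T0 h (S p) - fps_X (S p)) (fun x => h x - x)).
  { rewrite <- T0_minus_id by exact Sh. apply smooth_lead.
    - exact (smooth_minus h (fun x => x) Sh smooth_id).
    - intros j Hj. rewrite T0_minus_id by exact Sh. auto. }
  apply (lead_scal _ (-1)) in L. apply lead_pos in L; [|lra].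
  destruct L as [e [He H]]. exists e. split; [exact He|]. intros x Hx. specialize (H x Hx).
  assert (0 < -1 * (T0 h (S p) - fps_X (S p)) / 2 * x ^ S p)
    by (apply Rmult_lt_0_compat; [lra|apply pow_lt; lra]).
  lra.
Qed.

(** Either [h] or its inverse [k] has a positive first deviation: if both were negative, then
    [h (k x) < k x < x] for small [x > 0]. No formula for the leading coefficient of the inverse is
    involved. *)
Lemma flat_centralizer_right (h F : R -> R) : diffeo_plus h -> h 0 = 0 -> T0 h <> fps_X ->
  smooth F -> T0 F = fps_X -> (forall x, h (F x) = F (h x)) ->
  exists d, 0 < d /\ forall x, 0 < x < d -> F x = x.
Proof.
  intros [[Sh [k [Sk [Hkh Hhk]]]] Hinc] H0 N SF EF Hcom.
  assert (K0 : k 0 = 0) by (rewrite <- H0 at 1; apply Hkh).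
  pose proof (inverse_increasing h k Hinc Hhk) as Kinc.
  destruct (first_deviation h Sh H0 N) as [p [Hp Hlow]].
  destruct (Rlt_le_dec 0 (T0 h (S p) - fps_X (S p))) as [P|P].
  { apply (lead_expanding_fix h k F p); assumption. }
  assert (Nk : T0 k <> fps_X).
  { intros Ek. apply N.
    (* Writing [h] as [h o id] lets [T0 k] replace [X], and [T0 h] becomes the series of
       [h o k = id]. *)
    rewrite (T0_comp h (fun x => x) Sh smooth_id eq_refl : T0 h = _), T0_id, <- Ek.
    rewrite <- T0_comp, Ek, <- T0_id by assumption.
    f_equal. apply functional_extensionality, Hhk. }
  destruct (first_deviation k Sk K0 Nk) as [p' [Hp' Hlow']].
  destruct (Rlt_le_dec 0 (T0 k (S p') - fps_X (S p'))) as [P'|P'].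
  { apply (lead_expanding_fix k h F p'); try assumption.
    intros x. rewrite <- (Hhk x) at 1. rewrite <- Hcom. apply Hkh. }
  exfalso.
  destruct (lead_contracting h p Sh) as [e [He H]]; [lra|exact Hlow|].
  destruct (lead_contracting k p' Sk) as [e' [He' H']]; [lra|exact Hlow'|].
  set (x := Rmin e e' / 2).
  assert (Hx : 0 < x) by (apply Rdiv_lt_0_compat; [apply Rmin_pos; assumption|lra]).
  pose proof (Rmin_l e e'). pose proof (Rmin_r e e').
  assert (Hkx : k x < x) by (apply H'; unfold x in *; lra).
  assert (Hk0 : 0 < k x) by (rewrite <- K0; apply Kinc, Hx).
  assert (h (k x) < k x) by (apply H; unfold x in *; lra).
  rewrite Hhk in H3. lra.
Qed.

Lemma reflect_id_jet (u : R -> R) : smooth u -> u 0 = 0 -> T0 u = fps_X ->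
  T0 (fun x => - u (- x)) = fps_X.
Proof.
  intros Su U0 E. pose proof (smooth_opp _ smooth_id) as So.
  rewrite (T0_comp (fun x => - x) (fun x => u (- x))).
  - rewrite (T0_comp u (fun x => - x)), E, <- T0_id; auto using Ropp_0.
    rewrite <- (T0_comp (fun x => x) (fun x => - x)); auto using Ropp_0, smooth_id.
    rewrite <- (T0_comp (fun x => - x) (fun x => - x)); auto using Ropp_0.
    f_equal. apply functional_extensionality. intros x. ring.
  - exact So.
  - exact (smooth_comp u _ Su So).
  - rewrite Ropp_0. exact U0.
Qed.

Lemma smooth_reflect (u : R -> R) : smooth u -> smooth (fun x => - u (- x)).
Proof.
  intros Su. pose proof (smooth_opp _ smooth_id) as So.
  exact (smooth_opp _ (smooth_comp u _ Su So)).
Qed.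

Lemma diffeo_plus_reflect (h : R -> R) : diffeo_plus h -> diffeo_plus (fun x => - h (- x)).
Proof.
  intros [[Sh [k [Sk [Hkh Hhk]]]] Hinc]. split; [split|].
  - apply smooth_reflect, Sh.
  - exists (fun x => - k (- x)). split; [apply smooth_reflect, Sk|].
    split; intros x; rewrite Ropp_involutive, ?Hkh, ?Hhk; ring.
  - intros x y Hxy. apply Ropp_lt_contravar, Hinc. lra.
Qed.

(** Conjugation by [x |-> - x] exchanges the half-lines and preserves nontriviality of the jet, so
    the one-sided result applies twice. *)
Lemma flat_centralizer (h F : R -> R) : diffeo_plus h -> h 0 = 0 -> T0 h <> fps_X ->
  smooth F -> F 0 = 0 -> T0 F = fps_X -> (forall x, h (F x) = F (h x)) ->
  exists d, 0 < d /\ forall x, Rabs x < d -> F x = x.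
Proof.
  intros Dh H0 N SF F0 EF Hcom.
  destruct (flat_centralizer_right h F Dh H0 N SF EF Hcom) as [d [Hd K]].
  destruct (flat_centralizer_right (fun x => - h (- x)) (fun x => - F (- x)))
    as [d' [Hd' K']].
  - apply diffeo_plus_reflect, Dh.
  - rewrite Ropp_0, H0. ring.
  - intros E. apply N. pose proof (proj1 (proj1 Dh)) as Sh.
    apply reflect_id_jet in E; [|apply smooth_reflect, Sh|rewrite Ropp_0, H0; ring].
    rewrite <- E. f_equal. apply functional_extensionality. intros x.
    rewrite !Ropp_involutive. reflexivity.
  - apply smooth_reflect, SF.
  - apply reflect_id_jet; assumption.
  - intros x. rewrite !Ropp_involutive, Hcom. reflexivity.
  - exists (Rmin d d'). split; [apply Rmin_pos; assumption|]. intros x Hx.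
    pose proof (Rmin_l d d'). pose proof (Rmin_r d d').
    destruct (Rtotal_order x 0) as [L|[->|L]]; [|exact F0|].
    + rewrite Rabs_left in Hx by exact L. specialize (K' (- x)).
      rewrite Ropp_involutive in K'. lra.
    + rewrite Rabs_pos_eq in Hx by lra. apply K. lra.
Qed.

(** * Cut-offs *)

(* The powers of [/ x] make the family closed under differentiation. *)
Definition flat_exp (k : nat) (x : R) : R :=
  if Rlt_dec 0 x then (/ x) ^ k * exp (- / x) else 0.

Lemma flat_exp_pos (k : nat) (x : R) : 0 < x -> flat_exp k x = (/ x) ^ k * exp (- / x).
Proof. intros H. unfold flat_exp. destruct (Rlt_dec 0 x); [reflexivity|lra]. Qed.

Lemma flat_exp_neg (k : nat) (x : R) : x <= 0 -> flat_exp k x = 0.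
Proof. intros H. unfold flat_exp. destruct (Rlt_dec 0 x); [lra|reflexivity]. Qed.

Lemma exp_pow (x : R) (n : nat) : exp x ^ n = exp (INR n * x).
Proof.
  induction n as [|n IH]; [simpl; rewrite Rmult_0_l, exp_0; reflexivity|].
  rewrite <- tech_pow_Rmult, IH, <- exp_plus, S_INR. f_equal. ring.
Qed.

(** The [S n]-th power of [s <= exp s] at [s = t / INR (S n)]. *)
Lemma pow_le_exp (t : R) (n : nat) : 0 <= t -> t ^ S n <= INR (S n) ^ S n * exp t.
Proof.
  intros Ht. assert (Hn : 0 < INR (S n)) by (apply lt_0_INR; lia).
  replace t with (INR (S n) * (t / INR (S n))) at 2 by (field; lra).
  rewrite <- exp_pow, <- Rpow_mult_distr. apply pow_incr. split; [exact Ht|].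
  replace t with (INR (S n) * (t / INR (S n))) at 1 by (field; lra).
  apply Rmult_le_compat_l; [lra|].
  pose proof (exp_ineq1_le (t / INR (S n))). lra.
Qed.

(** Quadratic decay gives derivative 0 at the origin. The bound is [pow_le_exp] at [t = / x] with
    exponent [k + 2]. *)
Lemma flat_exp_le_sqr (k : nat) :
  exists M, 0 < M /\ forall x, Rabs (flat_exp k x) <= M * Rabs x * Rabs x.
Proof.
  exists (INR (S (S k)) ^ S (S k)). split; [apply pow_lt, lt_0_INR; lia|]. intros x.
  destruct (Rlt_le_dec 0 x) as [P|P].
  - rewrite flat_exp_pos by exact P. pose proof (Rinv_0_lt_compat x P) as Hi.
    pose proof (pow_le_exp (/ x) (S k) (Rlt_le _ _ Hi)) as H.
    rewrite (Rabs_pos_eq x) by lra.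
    rewrite Rabs_pos_eq by (apply Rmult_le_pos; [apply pow_le; lra|left; apply exp_pos]).
    apply Rmult_le_reg_r with (exp (/ x) * (/ x * / x)).
    { repeat apply Rmult_lt_0_compat; auto using exp_pos. }
    replace ((/ x) ^ k * exp (- / x) * (exp (/ x) * (/ x * / x)))
      with ((/ x) ^ S (S k) * (exp (- / x) * exp (/ x))) by (simpl; ring).
    rewrite <- exp_plus, Rplus_opp_l, exp_0, Rmult_1_r.
    eapply Rle_trans; [exact H|]. right. field. lra.
  - rewrite flat_exp_neg, Rabs_R0 by exact P.
    apply Rmult_le_pos; [apply Rmult_le_pos; [apply pow_le, pos_INR|]|]; apply Rabs_pos.
Qed.

Lemma locally_near (x e : R) (P : R -> Prop) : 0 < e ->
  (forall y, Rabs (y - x) < e -> P y) -> locally x P.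
Proof. intros He H. exists (mkposreal e He). intros y Hy. apply H. exact Hy. Qed.

Lemma is_derive_flat_exp (k : nat) (x : R) :
  is_derive (flat_exp k) x (- INR k * flat_exp (S k) x + flat_exp (S (S k)) x).
Proof.
  destruct (Rtotal_order x 0) as [N|[Z|P]].
  - rewrite !flat_exp_neg, Rmult_0_r, Rplus_0_r by lra.
    apply is_derive_ext_loc with (fun _ => 0); [|apply @is_derive_const].
    apply locally_near with (- x); [lra|]. intros y Hy. apply Rabs_lt_between in Hy.
    symmetry. apply flat_exp_neg. lra.
  - subst x. rewrite !flat_exp_neg, Rmult_0_r, Rplus_0_r by lra.
    apply is_derive_Reals. intros eps Heps. destruct (flat_exp_le_sqr k) as [M [HM H]].
    assert (Hd : 0 < eps / M) by (apply Rdiv_lt_0_compat; assumption).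
    exists (mkposreal _ Hd). intros t Ht0 Ht. simpl in Ht.
    rewrite Rplus_0_l, (flat_exp_neg k 0), !Rminus_0_r by lra.
    unfold Rdiv. rewrite Rabs_mult, Rabs_inv.
    pose proof (Rabs_pos_lt _ Ht0) as Hp.
    apply Rmult_lt_reg_r with (Rabs t); [exact Hp|].
    rewrite Rmult_assoc, Rinv_l, Rmult_1_r by lra.
    eapply Rle_lt_trans; [apply H|]. apply Rmult_lt_compat_r; [exact Hp|].
    replace eps with (M * (eps / M)) by (field; lra). apply Rmult_lt_compat_l; assumption.
  - rewrite !flat_exp_pos by exact P.
    apply is_derive_ext_loc with (fun x => (/ x) ^ k * exp (- / x)).
    { apply locally_near with x; [lra|]. intros y Hy. apply Rabs_lt_between in Hy.
      symmetry. apply flat_exp_pos. lra. }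
    auto_derive; [lra|]. destruct k as [|k]; [simpl; field; lra|].
    simpl Nat.pred. rewrite <- !tech_pow_Rmult. field. lra.
Qed.

Lemma smooth_flat_exp (k : nat) : smooth (flat_exp k).
Proof.
  apply smooth_Cn. intros n. revert k. induction n as [|n IH]; intros k; [exact I|].
  exists (fun x => - INR k * flat_exp (S k) x + flat_exp (S (S k)) x).
  split; [intros; apply is_derive_flat_exp|].
  apply Cn_plus; [apply Cn_mult; [apply Cn_const|apply IH]|apply IH].
Qed.

Lemma flat_exp_0_pos (x : R) : 0 < x -> 0 < flat_exp 0 x.
Proof. intros H. rewrite flat_exp_pos by exact H. simpl. pose proof (exp_pos (- / x)). lra. Qed.

Lemma flat_exp_0_nonneg (x : R) : 0 <= flat_exp 0 x.
Proof.
  destruct (Rlt_le_dec 0 x) as [P|P]; [left; apply flat_exp_0_pos, P|].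
  rewrite flat_exp_neg by exact P. lra.
Qed.

(** It passes from 0 on [x <= 0] to 1 on [x >= 1]; the denominator is positive because [x] or
    [1 - x] is. *)
Definition smooth_step (x : R) : R := flat_exp 0 x * / (flat_exp 0 x + flat_exp 0 (1 - x)).

Lemma smooth_step_denom (x : R) : 0 < flat_exp 0 x + flat_exp 0 (1 - x).
Proof.
  pose proof (flat_exp_0_nonneg x). pose proof (flat_exp_0_nonneg (1 - x)).
  destruct (Rlt_le_dec 0 x) as [P|P].
  - pose proof (flat_exp_0_pos x P). lra.
  - assert (0 < flat_exp 0 (1 - x)) by (apply flat_exp_0_pos; lra). lra.
Qed.

Lemma smooth_smooth_step : smooth smooth_step.
Proof.
  pose proof (smooth_flat_exp 0) as S0.
  assert (S1 : smooth (fun x => flat_exp 0 (1 - x))).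
  { apply (smooth_comp (flat_exp 0) (fun x => 1 - x)); [exact S0|].
    apply (smooth_minus (fun _ => 1)); [apply smooth_const|exact smooth_id]. }
  apply (smooth_mult (flat_exp 0)); [exact S0|].
  apply (smooth_inv (fun x => flat_exp 0 x + flat_exp 0 (1 - x))).
  - intros x. apply Rgt_not_eq, smooth_step_denom.
  - apply smooth_plus; assumption.
Qed.

Lemma smooth_bump : exists chi : R -> R, smooth chi /\
  (forall x, Rabs x <= / 2 -> chi x = 1) /\ (forall x, 1 <= Rabs x -> chi x = 0) /\
  (forall x, Rabs (chi x) <= 1) /\
  exists M, 0 < M /\ forall x, Rabs (Derive chi x) <= M.
Proof.
  (* The argument is at least 1 for [|x| <= 1/2] and negative for [|x| >= 1]; squaring avoids the
     corner of the absolute value. *)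
  set (chi := fun x => smooth_step (2 - 4 * (x * x))).
  assert (Sc : smooth chi).
  { apply (smooth_comp smooth_step (fun x => 2 - 4 * (x * x))); [exact smooth_smooth_step|].
    apply (smooth_minus (fun _ => 2)); [apply smooth_const|].
    apply (smooth_mult (fun _ => 4)); [apply smooth_const|].
    apply (smooth_mult (fun x => x)); exact smooth_id. }
  assert (C0 : forall x, 1 <= Rabs x -> chi x = 0).
  { intros x Hx. unfold chi, smooth_step.
    assert (1 <= x * x) by (rewrite <- Rabs_pos_eq, Rabs_mult by nra; nra).
    rewrite flat_exp_neg by lra. ring. }
  exists chi. split; [exact Sc|]. split; [|split; [exact C0|split]].
  - intros x Hx. unfold chi, smooth_step.
    assert (x * x <= / 2 * / 2).
    { rewrite <- (Rabs_pos_eq (x * x)) by nra. rewrite Rabs_mult.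
      pose proof (Rabs_pos x). apply Rmult_le_compat; assumption. }
    rewrite (flat_exp_neg 0 (1 - _)), Rplus_0_r by lra.
    apply Rinv_r. apply Rgt_not_eq, flat_exp_0_pos. lra.
  - intros x. unfold chi, smooth_step. set (y := 2 - 4 * (x * x)).
    pose proof (flat_exp_0_nonneg y). pose proof (flat_exp_0_nonneg (1 - y)).
    pose proof (smooth_step_denom y) as P.
    rewrite Rabs_pos_eq.
    + apply Rmult_le_reg_r with (flat_exp 0 y + flat_exp 0 (1 - y)); [exact P|].
      rewrite Rmult_assoc, Rinv_l by lra. lra.
    + apply Rmult_le_pos; [assumption|]. left. apply Rinv_0_lt_compat, P.
  - assert (Cd : continuity (fun x => Rabs (Derive chi x))).
    { intros x. apply (continuity_pt_comp (Derive chi) Rabs);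
      [apply smooth_continuity, smooth_Derive, Sc|apply Rcontinuity_abs]. }
    destruct (continuity_ab_maj (fun x => Rabs (Derive chi x)) (-1) 1) as [t [Ht _]];
      [lra|intros; apply Cd|].
    exists (Rabs (Derive chi t) + 1). split; [pose proof (Rabs_pos (Derive chi t)); lra|].
    intros x. destruct (Rle_lt_dec (Rabs x) 1) as [L|L].
    + apply Rabs_le_between in L. specialize (Ht x L). lra.
    + rewrite (is_derive_unique chi x 0), Rabs_R0; [pose proof (Rabs_pos (Derive chi t)); lra|].
      apply is_derive_ext_loc with (fun _ => 0); [|apply @is_derive_const].
      apply locally_near with (Rabs x - 1); [lra|]. intros y Hy. symmetry. apply C0.
      pose proof (Rabs_triang_inv x y). rewrite Rabs_minus_sym in Hy. lra.
Qed.

(** The deviation [q] from the identity is multiplied by a bump of width [d]. The bump's slope grows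
    like [1 / d], but [q] is at most [eta * d] there because [Derive q 0 = 0]. *)
Lemma germ_extension (h0 : R -> R) (e : R) :
  smooth h0 -> h0 0 = 0 -> T0 h0 1%nat = 1 -> 0 < e ->
  exists h d, 0 < d < e /\ diffeo_plus h /\
    (forall x, Rabs x < d / 2 -> h x = h0 x) /\ (forall x, d <= Rabs x -> h x = x).
Proof.
  intros S0 H0 H1 He.
  destruct smooth_bump as [chi [Sc [C1 [C0 [Cb [M [HM Cd]]]]]]].
  set (q := fun x => h0 x - x).
  assert (Sq : smooth q) by exact (smooth_minus h0 (fun x => x) S0 smooth_id).
  assert (Dq0 : Derive q 0 = 0).
  { rewrite <- T0_0, T0_Derive. unfold q.
    rewrite (T0_minus h0 (fun x => x)), T0_id, H1 by auto using smooth_id.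
    unfold fps_X. simpl. ring. }
  (* Chosen so that [(M + 1) * eta = / 2], whence [Derive h >= / 2] whatever [d] is. *)
  set (eta := / (2 * (1 + M))).
  assert (Heta : 0 < eta) by (apply Rinv_0_lt_compat; lra).
  assert (Cq : locally 0 (fun x => Rabs (Derive q x) < eta)).
  { pose proof (smooth_continuity _ (smooth_Derive q Sq) 0) as Cq.
    apply continuity_pt_locally with (eps := mkposreal eta Heta) in Cq.
    revert Cq. apply filter_imp. intros x. rewrite Dq0, Rminus_0_r. auto. }
  destruct (locally0_inv _ Cq) as [r [Hr Kr]].
  set (d := Rmin e r / 2).
  assert (Hm : 0 < Rmin e r) by (apply Rmin_pos; assumption).
  pose proof (Rmin_l e r) as Hme. pose proof (Rmin_r e r) as Hmr.
  assert (Hd : 0 < d < e) by (unfold d; lra).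
  assert (Hq : forall x, Rabs x <= d -> Rabs (q x) <= eta * d).
  { intros x Hx. destruct (smooth_MVT q 0 x Sq) as [t [Ht E]].
    replace (q 0) with 0 in E by (unfold q; rewrite H0; ring).
    rewrite !Rminus_0_r in E. rewrite E, Rabs_mult.
    apply Rmult_le_compat; auto using Rabs_pos. left. apply Kr.
    apply Rle_lt_trans with d; [|unfold d; lra].
    apply Rabs_le_between in Hx. apply Rabs_le_between.
    unfold Rmin, Rmax in Ht. destruct (Rle_dec 0 x); lra. }
  set (b := fun x => chi (/ d * x)).
  assert (Sl : smooth (fun x => / d * x)).
  { apply (smooth_mult (fun _ => / d)); [apply smooth_const|exact smooth_id]. }
  assert (Sb : smooth b) by exact (smooth_comp chi _ Sc Sl).
  assert (Hab : forall x, Rabs (/ d * x) = / d * Rabs x).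
  { intros x. rewrite Rabs_mult, Rabs_pos_eq; [reflexivity|].
    left. apply Rinv_0_lt_compat. lra. }
  assert (B1 : forall x, Rabs x < d / 2 -> b x = 1).
  { intros x Hx. apply C1. rewrite Hab. replace (/ 2) with (/ d * (d / 2)) by (field; lra).
    apply Rmult_le_compat_l; [left; apply Rinv_0_lt_compat|]; lra. }
  assert (B0 : forall x, d <= Rabs x -> b x = 0).
  { intros x Hx. apply C0. rewrite Hab. replace 1 with (/ d * d) by (field; lra).
    apply Rmult_le_compat_l; [left; apply Rinv_0_lt_compat|]; lra. }
  assert (Db : forall x, is_derive b x (/ d * Derive chi (/ d * x))).
  { intros x. apply (is_derive_comp chi (fun x => / d * x)).
    - apply smooth_is_derive, Sc.
    - auto_derive; [exact I|ring]. }
  set (h := fun x => x + b x * q x).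
  assert (Sh : smooth h).
  { apply (smooth_plus (fun x => x)); [exact smooth_id|]. apply smooth_mult; assumption. }
  exists h, d. split; [exact Hd|]. split; [|split].
  - apply diffeo_plus_intro with (/ 2); [exact Sh|lra|]. intros x.
    destruct (Rle_lt_dec (Rabs x) d) as [L|L].
    + assert (D : is_derive h x (1 + (/ d * Derive chi (/ d * x) * q x + b x * Derive q x))).
      { apply (is_derive_plus (fun x => x) (fun x => b x * q x)); [apply @is_derive_id|].
        apply (is_derive_mult b q); [apply Db|apply smooth_is_derive, Sq|].
        intros; apply Rmult_comm. }
      rewrite (is_derive_unique _ _ _ D).
      assert (T1 : Rabs (/ d * Derive chi (/ d * x) * q x) <= M * eta).
      { rewrite !Rabs_mult, (Rabs_pos_eq (/ d)) by (left; apply Rinv_0_lt_compat; lra).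
        replace (M * eta) with (/ d * M * (eta * d)) by (field; lra).
        assert (0 < / d) by (apply Rinv_0_lt_compat; lra).
        apply Rmult_le_compat; [|apply Rabs_pos| |apply Hq, L].
        - apply Rmult_le_pos; [lra|apply Rabs_pos].
        - apply Rmult_le_compat_l; [lra|apply Cd]. }
      assert (T2 : Rabs (b x * Derive q x) <= eta).
      { rewrite Rabs_mult, <- (Rmult_1_l eta). apply Rmult_le_compat; auto using Rabs_pos.
        - apply Cb.
        - left. apply Kr. unfold d in L. lra. }
      assert (E : M * eta + eta = / 2) by (unfold eta; field; lra).
      apply Rabs_le_between in T1. apply Rabs_le_between in T2. lra.
    + rewrite (is_derive_unique h x 1); [lra|].
      apply is_derive_ext_loc with (fun x => x); [|apply @is_derive_id].
      apply locally_near with (Rabs x - d); [lra|]. intros y Hy.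
      change (y = y + b y * q y).
      rewrite B0; [ring|]. pose proof (Rabs_triang_inv x y). rewrite Rabs_minus_sym in Hy. lra.
  - intros x Hx. unfold h, q. rewrite B1 by exact Hx. ring.
  - intros x Hx. unfold h. rewrite B0 by exact Hx. ring.
Qed.

(** * Conjugacy *)

(** A conjugacy of germs suffices, since Taylor series depend only on germs. *)
Lemma T0_conj (f g h : R -> R) :
  smooth f -> smooth g -> g 0 = 0 -> diffeo_plus h -> h 0 = 0 ->
  locally 0 (fun x => h (f x) = g (h x)) ->
  T0 f = fps_comp (fps_inv (T0 h)) (fps_comp (T0 g) (T0 h)).
Proof.
  intros Sf Sg G0 [[Sh [k [Sk [Hkh Hhk]]]] _] H0 Hloc.
  rewrite (T0_inverse h k) by assumption.
  rewrite <- (T0_comp g h) by assumption.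
  rewrite <- (T0_comp k (fun x => g (h x))).
  - apply T0_ext_loc; [exact Sf| |].
    + exact (smooth_comp k _ Sk (smooth_comp g h Sg Sh)).
    + revert Hloc. apply filter_imp. intros x E. rewrite <- E. symmetry. apply Hkh.
  - exact Sk.
  - apply smooth_comp; assumption.
  - rewrite H0. exact G0.
Qed.

Lemma diffeo_plus_id : diffeo_plus (fun x => x).
Proof. split; [split; [exact smooth_id|exists (fun x => x); auto using smooth_id]|auto]. Qed.

Lemma fps_conj_X (g : R -> R) : smooth g -> g 0 = 0 ->
  fps_comp (fps_inv fps_X) (fps_comp (T0 g) fps_X) = T0 g.
Proof.
  intros Sg G0. rewrite <- T0_id. symmetry.
  apply T0_conj; auto using diffeo_plus_id. apply filter_forall. reflexivity.
Qed.

(** As [f] is decreasing, the derivative [(1 - f') / 2] is at least [1 / 2]. Where [f (f x) = x],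
    the map sends [f x] to minus its value at [x]. *)
Lemma linearizer (f : R -> R) : diffeo_minus f ->
  diffeo_plus (fun x => / 2 * (x - f x)).
Proof.
  intros [[Sf _] Hdec].
  assert (S : smooth (fun x => / 2 * (x - f x))).
  { apply (smooth_mult (fun _ => / 2)); [apply smooth_const|].
    apply (smooth_minus (fun x => x)); [exact smooth_id|exact Sf]. }
  apply diffeo_plus_intro with (/ 2); [exact S|lra|]. intros x.
  rewrite (is_derive_unique _ x (/ 2 * (1 - Derive f x))).
  - enough (Derive f x <= 0) by lra.
    assert (P : forall y, 0 <= - Derive f y).
    { intros y. rewrite <- Derive_opp.
      destruct (Rle_lt_dec 0 (Derive (fun x => - f x) y)) as [L|L]; [exact L|exfalso].
      pose proof (smooth_is_derive _ y (smooth_opp f Sf)) as D.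
      apply is_derive_Reals in D.
      destruct (D (- Derive (fun x => - f x) y)) as [del Hdel]; [lra|].
      pose proof (cond_pos del) as Hp.
      specialize (Hdel (del / 2)). rewrite Rabs_pos_eq in Hdel by lra.
      assert (A1 : del / 2 <> 0) by lra. assert (A2 : del / 2 < del) by lra.
      specialize (Hdel A1 A2). apply Rabs_lt_between in Hdel.
      assert (f (y + del / 2) < f y) by (apply Hdec; lra).
      assert (0 < (- f (y + del / 2) - - f y) / (del / 2)) by (apply Rdiv_lt_0_compat; lra).
      lra. }
    specialize (P x). lra.
  - apply (is_derive_scal (fun x => x - f x)).
    apply (is_derive_minus (fun x => x) f); [apply @is_derive_id|apply smooth_is_derive, Sf].
Qed.

Lemma interior_involution_conj (f g : R -> R) :
  diffeo_minus f -> diffeo_minus g -> f 0 = 0 -> g 0 = 0 ->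
  (forall x, f (f x) = g (g x)) -> interior_fix0 f ->
  exists h, diffeo_plus h /\ h 0 = 0 /\ (forall x, h (f (f x)) = f (f (h x))) /\
    locally 0 (fun x => h (f x) = g (h x)).
Proof.
  intros Df Dg F0 G0 E [e [He Hfix]].
  pose proof (linearizer f Df) as Lf. pose proof (linearizer g Dg) as Lg.
  set (phi := fun x => / 2 * (x - f x)) in Lf. set (psi := fun x => / 2 * (x - g x)) in Lg.
  destruct Lf as [[Sphi _] _]. destruct Lg as [[Spsi [k [Sk [Hk1 Hk2]]]] Psiinc].
  assert (Sf : smooth f) by apply Df. assert (Sg : smooth g) by apply Dg.
  set (F := fun x => f (f x)).
  assert (TF : T0 F 1%nat = 1).
  { transitivity (fps_X 1%nat); [|reflexivity].
    apply (f_equal (fun s : fps => s 1%nat)). rewrite <- T0_id. apply T0_ext_loc.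
    - exact (smooth_comp f f Sf Sf).
    - exact smooth_id.
    - generalize (locally0_lt e He). apply filter_imp. exact Hfix. }
  assert (Slope : forall u : R -> R, smooth u -> u 0 = 0 -> T0 u 1%nat = -1 ->
            lead 1 1 (fun x => / 2 * (x - u x))).
  { intros u Su U0 U1. replace 1 with (/ 2 * (1 - -1)) at 1 by field.
    apply (lead_scal 1 (/ 2)). apply lead_minus.
    - apply lead_ext with (fun x => 1 * x ^ 1); [intros; ring|apply lead_monom].
    - rewrite <- U1. apply smooth_lead_1; assumption. }
  assert (Lphi : lead 1 1 phi) by (apply Slope; auto; apply root_slope; assumption).
  assert (Lpsi : lead 1 1 psi).
  { apply Slope; auto. apply root_slope; try assumption. rewrite <- TF. f_equal.
    apply functional_extensionality. intros x. symmetry. apply E. }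
  assert (Phi0 : phi 0 = 0) by (unfold phi; rewrite F0; ring).
  assert (Psi0 : psi 0 = 0) by (unfold psi; rewrite G0; ring).
  assert (K0 : k 0 = 0) by (rewrite <- Psi0 at 1; apply Hk1).
  pose proof (smooth_lead_1 k Sk K0) as Lk.
  assert (K1 : T0 k 1%nat = 1).
  { pose proof (lead_comp _ _ _ _ _ Lk Lpsi) as L. rewrite pow1, Rmult_1_r in L.
    apply (lead_unique 1) with (fun x => k (psi x)); [exact L|].
    apply lead_ext with (fun x => 1 * x ^ 1); [|apply lead_monom].
    intros x. rewrite Hk1. ring. }
  (* That is [psi^-1 o phi]; both factors have slope 1 because [f] and [g] have slope -1. *)
  set (h0 := fun x => k (phi x)).
  assert (Sh0 : smooth h0) by exact (smooth_comp k phi Sk Sphi).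
  assert (H00 : h0 0 = 0) by (unfold h0; rewrite Phi0; exact K0).
  assert (H01 : T0 h0 1%nat = 1).
  { apply (lead_unique 1) with h0; [apply smooth_lead_1; assumption|].
    pose proof (lead_comp _ _ _ _ _ Lk Lphi) as L.
    rewrite K1, pow1, Rmult_1_r in L. exact L. }
  destruct (germ_extension h0 e Sh0 H00 H01 He) as [h [d [[Hd Hde] [Dh [Hin Hout]]]]].
  assert (Hinc := proj2 Dh).
  exists h. split; [exact Dh|].
  assert (HH0 : h 0 = 0) by (rewrite Hin; [exact H00|rewrite Rabs_R0; lra]).
  split; [exact HH0|].
  assert (Dd : h d = d) by (apply Hout; rewrite Rabs_pos_eq; lra).
  assert (Dmd : h (- d) = - d) by (apply Hout; rewrite Rabs_Ropp, Rabs_pos_eq; lra).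
  assert (Fd : f (f d) = d) by (apply Hfix; rewrite Rabs_pos_eq; lra).
  assert (Fmd : f (f (- d)) = - d) by (apply Hfix; rewrite Rabs_Ropp, Rabs_pos_eq; lra).
  assert (Finc : forall x y, x <= y -> f (f x) <= f (f y)).
  { intros x y [L|L]; [left; apply Df, Df, L|rewrite L; lra]. }
  split.
  (* Inside, [h] preserves [(-d, d)] and [F] is the identity there; outside, [F] preserves the
     complement and [h] is the identity there. *)
  - intros x. destruct (Rlt_le_dec (Rabs x) d) as [L|L].
    + rewrite (Hfix x) by lra. symmetry. apply Hfix.
      apply Rabs_lt_between in L.
      assert (h x < h d) by (apply Hinc; lra). assert (h (- d) < h x) by (apply Hinc; lra).
      apply Rabs_lt_between. lra.
    + rewrite (Hout x L). apply Hout.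
      destruct (Rle_lt_dec 0 x) as [P|P].
      * rewrite Rabs_pos_eq in L by exact P. pose proof (Finc d x L).
        rewrite Rabs_pos_eq; lra.
      * rewrite Rabs_left in L by exact P. assert (L' : x <= - d) by lra.
        pose proof (Finc x (- d) L'). rewrite Rabs_left; lra.
  - assert (Psiinj : forall x y, psi x = psi y -> x = y).
    { intros x y Exy. rewrite <- (Hk1 x), Exy. apply Hk1. }
    assert (N1 : forall u : R -> R, continuity u -> u 0 = 0 -> forall r, 0 < r ->
              locally 0 (fun x => Rabs (u x) < r)).
    { intros u Cu U0 r Hr. specialize (Cu 0).
      apply continuity_pt_locally with (eps := mkposreal r Hr) in Cu. revert Cu.
      apply filter_imp. intros x. rewrite U0, Rminus_0_r. auto. }
    assert (Hd2 : 0 < d / 2) by lra.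
    (* Near 0, both [x] and [f x] lie where [h = h0], and [h0 x] lies where [F] is the identity. *)
    generalize (filter_and _ _ (locally0_lt _ Hd2)
      (filter_and _ _ (N1 f (smooth_continuity f Sf) F0 _ Hd2)
                      (N1 h0 (smooth_continuity h0 Sh0) H00 _ He))).
    apply filter_imp. intros x [X1 [X2 X3]]. rewrite !Hin by assumption.
    (* After applying [psi], both sides equal [- phi x]. *)
    apply Psiinj. unfold h0 at 1. rewrite Hk2. unfold phi. rewrite Hfix by lra.
    unfold psi. rewrite <- E, Hfix by exact X3.
    change (/ 2 * (f x - x) = / 2 * (g (h0 x) - h0 x)).
    assert (P : psi (h0 x) = phi x) by apply Hk2. unfold psi, phi in P. lra.
Qed.

Theorem theorem2p3 (f g : R -> R) :
  diffeo_minus f -> diffeo_minus g -> f 0 = 0 -> g 0 = 0 ->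
  (forall x, f (f x) = g (g x)) ->
  ((exists h : R -> R, diffeo_plus h /\ h 0 = 0 /\
      (forall x, h (f (f x)) = f (f (h x))) /\
      T0 f = fps_comp (fps_inv (T0 h)) (fps_comp (T0 g) (T0 h)))
   <->
   (fps_comp (T0 f) (T0 f) <> fps_X \/
    interior_fix0 f \/
    (fps_comp (T0 f) (T0 f) = fps_X /\ boundary_fix0 f /\ T0 f = T0 g))).
Proof.
  intros Df Dg F0 G0 E.
  assert (Sf : smooth f) by apply Df. assert (Sg : smooth g) by apply Dg.
  assert (SF : smooth (fun x => f (f x))) by exact (smooth_comp f f Sf Sf).
  rewrite <- (T0_comp f f Sf Sf F0).
  assert (Hid : T0 f = T0 g -> exists h : R -> R, diffeo_plus h /\ h 0 = 0 /\
      (forall x, h (f (f x)) = f (f (h x))) /\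
      T0 f = fps_comp (fps_inv (T0 h)) (fps_comp (T0 g) (T0 h))).
  { intros T. exists (fun x => x). split; [exact diffeo_plus_id|].
    split; [reflexivity|]. split; [reflexivity|].
    rewrite T0_id, fps_conj_X by assumption. exact T. }
  split.
  - intros [h [Dh [H0 [Hcom Hconj]]]].
    destruct (classic (T0 (fun x => f (f x)) = fps_X)) as [TF|TF]; [right|left; exact TF].
    destruct (classic (interior_fix0 f)) as [Int|Int]; [left; exact Int|right].
    split; [exact TF|]. split.
    (* The point 0 is itself fixed, and failure of the interior condition supplies non-fixed points
       arbitrarily near it. *)
    + intros eps Heps. split.
      * exists 0. rewrite Rabs_R0, !F0. auto.
      * apply NNPP. intros N. apply Int. exists eps. split; [exact Heps|].
        intros x Hx. apply NNPP. intros Nx. apply N. exists x. auto.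
    + destruct (classic (T0 h = fps_X)) as [TH|TH].
      * rewrite Hconj, TH. apply fps_conj_X; assumption.
      * exfalso. apply Int.
        apply (flat_centralizer h (fun x => f (f x))); try assumption.
        rewrite !F0. reflexivity.
  - intros [TF|[Int|[_ [_ T]]]]; [| |exact (Hid T)].
    + apply Hid. apply square_root_jet_unique; assumption.
    + destruct (interior_involution_conj f g Df Dg F0 G0 E Int) as [h [Dh [H0 [Hcom Hloc]]]].
      exists h. split; [exact Dh|]. split; [exact H0|]. split; [exact Hcom|].
      apply T0_conj; assumption.
Qed.
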